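(* Let $f,g:\mathbb{R}^{2}\rightarrow\mathbb{R}$ be functions with continuous first order derivatives, let $1\leqslant p<2$, and let $\gamma:[0,1]\rightarrow\mathbb{R}^{2}$ be a positively oriented Jordan curve with finite $p$-variation. Let $x_{\cdot},y_{\cdot}$ denote the first and second coordinate components of $\gamma_{\cdot}$ respectively. Then $$\int_{0}^{1}\left(f(\gamma_{s})\,\mathrm{d}y_{s}-g(\gamma_{s})\,\mathrm{d}x_{s}\right)=\int_{\mathrm{Int}(\gamma)}\left(\frac{\partial f}{\partial x}+\frac{\partial g}{\partial y}\right)\mathrm{d}x\,\mathrm{d}y,$$ where the integral on the left-hand side is understood as a Young integral, and $\mathrm{Int}(\gamma)$ denotes the interior of $\gamma$.
   Context: A Jordan curve is a continuous map $\gamma:[0,1]\to\mathbb{R}^2$ with $\gamma_0=\gamma_1$ that is injective on $[0,1)$. $\mathrm{Int}(\gamma)$ is the bounded connected component of $\mathbb{R}^2\setminus\gamma([0,1])$. $\gamma$ is positively oriented if its winding number around the points of $\mathrm{Int}(\gamma)$ is $+1$ (counterclockwise). A function $\gamma:[0,1]\to X$ into a metric space $(X,d)$ has finite $p$-variation if $$\|\gamma\|_p:=\Big(\sup_{\mathcal{P}}\sum_{i} d(\gamma_{t_i},\gamma_{t_{i+1}})^p\Big)^{1/p}<\infty,$$ the supremum being over all finite partitions $\mathcal{P}: t_0<t_1<\cdots<t_n$ of $[0,1]$. Young integral: if $\phi,\psi:[0,1]\to\mathbb{R}$ are continuous with finite $p$-variation and $q$-variation respectively, where $p,q\geqslant1$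 and $\frac1p+\frac1q>1$, then $\int_0^1\phi_s\,\mathrm{d}\psi_s:=\lim_{\|\mathcal{P}\|\to0}\sum_{i}\phi_{t_i}(\psi_{t_{i+1}}-\psi_{t_i})$, the limit being over finite partitions $\mathcal{P}:0=t_0<\cdots<t_n=1$ with mesh tending to $0$; this limit exists by a theorem of L.C. Young. *)

(* Defs.v *)
From HB Require Import structures.
From mathcomp Require Import all_boot all_order all_algebra.
From mathcomp Require Import all_classical all_reals all_analysis.

Set Implicit Arguments.
Unset Strict Implicit.
Unset Printing Implicit Defensive.

Import Order.TTheory GRing.Theory Num.Theory.
Import numFieldNormedType.Exports.

Local Open Scope classical_set_scope.
Local Open Scope ring_scope.

(* A curve [0,1] -> R^2 is a total function R -> R * R of which only the
   restriction to `[0, 1] matters. *)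

Section Defs.
Context {R : realType}.
Implicit Types (gamma : R -> R * R) (phi psi : R -> R) (z w : R * R).

(* The norm of the library on R * R is the max norm. *)
Definition edist z w : R :=
  Num.sqrt ((z.1 - w.1) ^+ 2 + (z.2 - w.2) ^+ 2).

(* As in [itv_partition 0 1 s], a partition 0 = t_0 < ... < t_n = 1 is
   represented by s = [:: t_1; ...; t_n]. *)
Definition ppoint (s : seq R) (i : nat) : R := nth 1 (0 :: s) i.

Definition mesh (s : seq R) : R :=
  \big[Num.max/0]_(i < size s) (ppoint s i.+1 - ppoint s i).

Definition pvar_sum (p : R) gamma (s : seq R) : R :=
  \sum_(i < size s)
    edist (gamma (ppoint s i)) (gamma (ppoint s i.+1)) `^ p.

Definition pvariation (p : R) gamma : \bar R :=
  poweR (ereal_sup [set (pvar_sum p gamma s)%:E | s in itv_partition 0 1]) p^-1.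

Definition finite_pvariation (p : R) gamma : Prop :=
  (pvariation p gamma < +oo)%E.

Definition young_sum phi psi (s : seq R) : R :=
  \sum_(i < size s)
    phi (ppoint s i) * (psi (ppoint s i.+1) - psi (ppoint s i)).

Definition mesh_to_0 : set_system (seq R) :=
  filter_from [set d : R | 0 < d]
    (fun d => [set s | itv_partition 0 1 s /\ mesh s < d]).

(* [lim] is total; the limit exists for continuous phi, psi of finite p- and
   q-variation with p, q >= 1 and 1/p + 1/q > 1 (Young). *)
Definition young_integral phi psi : R :=
  lim (young_sum phi psi s @[s --> mesh_to_0]).

Definition jordan_curve gamma : Prop :=
  [/\ {within `[0, 1], continuous gamma},
      gamma 0 = gamma 1 &
      {in `[0, 1[ &, injective gamma}].

Definition curve_image gamma : set (R * R) := gamma @` `[0, 1].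

(* The points off the curve whose connected component is bounded. For a Jordan
   curve there is exactly one bounded component (Jordan's theorem), and it is
   then equal to this set: see [jordan_int_component]. *)
Definition jordan_int gamma : set (R * R) :=
  [set z | ~ curve_image gamma z /\
     bounded_set (connected_component (~` curve_image gamma) z)].

Definition bounded_component gamma (C : set (R * R)) : Prop :=
  bounded_set C /\
  exists2 z, ~ curve_image gamma z &
             C = connected_component (~` curve_image gamma) z.

Lemma jordan_int_component gamma (C : set (R * R)) :
  bounded_component gamma C ->
  (forall C', bounded_component gamma C' -> C' = C) ->
  jordan_int gamma = C.
Proof.
move=> [bC [z _ Cz]] uC; apply/seteqP; split => w.
  move=> [nw bw]; rewrite -(uC (connected_component (~` curve_image gamma) w)).
    exact: connected_component_refl.
  by split => //; exists w.
move=> Cw; have zw : connected_component (~` curve_image gamma) z w.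
  by rewrite -Cz.
split; first exact: (connected_component_sub zw).
by rewrite -(same_connected_component zw) -Cz.
Qed.

(* The total change of a continuous argument of gamma - z along [0, 1],
   counted in turns; such an argument exists only if z is off the curve. *)
Definition has_winding_number gamma z (k : int) : Prop :=
  exists rho theta : R -> R,
    [/\ {within `[0, 1], continuous theta},
        forall t, 0 <= t <= 1 -> 0 < rho t /\
          gamma t = (z.1 + rho t * cos (theta t), z.2 + rho t * sin (theta t)) &
        theta 1 - theta 0 = 2 * pi * k%:~R].

Definition positively_oriented gamma : Prop :=
  forall z, jordan_int gamma z -> has_winding_number gamma z 1.

Definition partial_x (f : R * R -> R) : R * R -> R := 'D_((1, 0) : R * R) f.
Definition partial_y (f : R * R -> R) : R * R -> R := 'D_((0, 1) : R * R) f.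

Definition continuous_partials (f : R * R -> R) : Prop :=
  [/\ forall z, derivable f z (1, 0), forall z, derivable f z (0, 1),
      continuous (partial_x f) & continuous (partial_y f)].

End Defs.

(* Main.v *)
(* The staircase winding function of a partition s of [0, 1],
     w_s(u, v) = sum_i 1[u < x_i] (1[v < y_(i+1)] - 1[v < y_i]),
   is itself a Riemann sum, and integrating f_x against it gives, up to an error
   O(sum_i (y_(i+1) - y_i)^2), the Young sum of f(gamma) dy: on each rectangle
   this is Fubini and the fundamental theorem of calculus. As p < 2, the error
   tends to 0 with the mesh, so it suffices that w_s tends in L^1 to the
   indicator of the interior.
   - Off the curve, w_s(z) is eventually the winding number of gamma around z, and
     it is locally constant in z; hence it is 1 on the bounded components, by
     orientation, and 0 on the unbounded ones, by connectedness. No appeal to the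
     Jordan curve theorem is needed. The curve is Lebesgue-null since p < 2.
   - Young's argument bounds the L^1 distance between w_s and w_s' for s' refining
     s, because moving one point changes w_s by the indicator of a rectangle of
     area |dx| |dy|. Fatou's lemma along refinements of s then bounds the L^1
     distance from w_s to the indicator of the interior.
   For g dx, exchange the axes and sum by parts. *)
Require Import Defs.
From HB Require Import structures.
From mathcomp Require Import all_boot all_order all_algebra.
From mathcomp Require Import all_classical all_reals all_analysis.
From mathcomp Require Import measurable_realfun zify ring lra.

Set Implicit Arguments.
Unset Strict Implicit.
Unset Printing Implicit Defensive.

Import Order.TTheory GRing.Theory Num.Theory.
Import numFieldNormedType.Exports.

Local Open Scope classical_set_scope.
Local Open Scope ring_scope.

(** * Sums over partitions *)

Section csum.
Context {R : realType}.
Implicit Types (c d : R -> R -> R) (a b : R) (s t : seq R) (r : rel R).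

(** Recursion on the list with a separate starting point makes concatenation and induction direct;
    [csum_nth] links it to the indexed sums of the definitions. *)
Fixpoint csum c a s : R :=
  if s is b :: s' then c a b + csum c b s' else 0.

Lemma csum_nth x0 c a s :
  \sum_(i < size s) c (nth x0 (a :: s) i) (nth x0 (a :: s) i.+1) = csum c a s.
Proof.
elim: s a => [|b s IH] a /=; first by rewrite big_ord0.
by rewrite big_ord_recl /= -IH.
Qed.

Lemma csum_cat c a s t : csum c a (s ++ t) = csum c a s + csum c (last a s) t.
Proof. by elim: s a => [|b s IH] a /=; rewrite ?add0r// IH addrA. Qed.

Lemma csumD c d a s :
  csum (fun x y => c x y + d x y) a s = csum c a s + csum d a s.
Proof. by elim: s a => [|b s IH] a /=; rewrite ?addr0// IH addrACA. Qed.

Lemma csumN c a s : csum (fun x y => - c x y) a s = - csum c a s.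
Proof. by elim: s a => [|b s IH] a /=; rewrite ?oppr0// IH opprD. Qed.

Lemma csumB c d a s :
  csum (fun x y => c x y - d x y) a s = csum c a s - csum d a s.
Proof. by rewrite csumD csumN. Qed.

Lemma csumZ k c a s : csum (fun x y => k * c x y) a s = k * csum c a s.
Proof. by elim: s a => [|b s IH] a /=; rewrite ?mulr0// IH mulrDr. Qed.

Lemma csum_telescope (F : R -> R) a s :
  csum (fun x y => F y - F x) a s = F (last a s) - F a.
Proof.
by elim: s a => [|b s IH] a /=; rewrite ?subrr// IH addrC addrA subrK.
Qed.

Lemma eq_csum r c d a s : path r a s ->
  (forall x y, r x y -> c x y = d x y) -> csum c a s = csum d a s.
Proof.
move=> + cd; elim: s a => [//|b s IH] a /= /andP[ab pbs].
by rewrite cd// IH.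
Qed.

Lemma ler_csum r c d a s : path r a s ->
  (forall x y, r x y -> c x y <= d x y) -> csum c a s <= csum d a s.
Proof.
move=> + cd; elim: s a => [//|b s IH] a /= /andP[ab pbs].
by rewrite lerD// ?cd// IH.
Qed.

Lemma ler_norm_csum c a s : `|csum c a s| <= csum (fun x y => `|c x y|) a s.
Proof.
elim: s a => [|b s IH] a /=; first by rewrite normr0.
by rewrite (le_trans (ler_normD _ _))// lerD2l.
Qed.

End csum.

(** * Fine partitions and their dyadic refinements *)

Section partitions.
Context {R : realType}.
Implicit Types (a b delta : R) (s : seq R).

(** Both bounds are kept in the relation so that each step of a path carries all that is needed to
    use estimates valid on [0, 1]. With [last 0 s = 1], a path from 0 is a partition of mesh below
    delta. *)
Definition fine_step delta : rel R :=
  fun a b => [&& 0 <= a, a < b, b <= 1 & b - a < delta].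

Lemma path_last_ge delta a s : path (fine_step delta) a s -> a <= last a s.
Proof.
elim: s a => [//|b s IH] a /= /andP[/and4P[_ ab _ _] /IH]; exact/le_trans/ltW.
Qed.

Lemma path_last_le1 delta a s : a <= 1 -> path (fine_step delta) a s ->
  last a s <= 1.
Proof.
by elim: s a => [//|b s IH] a /= a1 /andP[/and4P[_ _ b1 _]]; exact: IH.
Qed.

Lemma fine_stepW delta delta' : delta <= delta' ->
  subrel (fine_step delta) (fine_step delta').
Proof.
by move=> dd a b /and4P[a0 ab b1 /lt_le_trans h]; apply/and4P; split=> //; exact: h.
Qed.

Lemma partition_fine_step delta s : itv_partition 0 1 s -> mesh s < delta ->
  path (fine_step delta) 0 s.
Proof.
move=> [ps /eqP ls] ms; apply/(pathP 1) => i si.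
have lt_next j : (j < size s)%N -> nth 1 (0 :: s) j < nth 1 s j.
  by move=> js; exact: (pathP 1 ps).
have mono j k : (j <= k < (size s).+1)%N -> nth 1 (0 :: s) j <= nth 1 (0 :: s) k.
  elim: k => [|k IH]; first by rewrite leqn0 => /andP[/eqP->].
  move=> /andP[]; rewrite leq_eqVlt => /orP[/eqP->//|]; rewrite ltnS => jk.
  rewrite ltnS => ks; apply: (le_trans (IH _)); first by rewrite jk ltnW.
  exact/ltW/lt_next.
have lastE : nth 1 (0 :: s) (size s) = 1 by rewrite -[RHS]ls; exact: (nth_last 1 (0 :: s)).
apply/and4P; split.
- by have := mono 0%N i; apply; rewrite /= ltnW.
- exact: lt_next.
- by rewrite -[leRHS]lastE; apply: (mono i.+1 (size s)); rewrite si/=.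
- apply: le_lt_trans ms; rewrite /mesh.
  exact: (le_bigmax_cond 0 (fun i : 'I_(size s) => ppoint s i.+1 - ppoint s i) (j := Ordinal si)).
Qed.

(** The left endpoint is left out, as in [itv_partition], so that subdivisions of adjacent intervals
    concatenate. *)
Fixpoint halve n a b : seq R :=
  if n is m.+1 then halve m a ((a + b) / 2) ++ halve m ((a + b) / 2) b
  else [:: b].

Lemma last_halve n a b : last a (halve n a b) = b.
Proof.
by elim: n a b => [//|n IH] a b /=; rewrite last_cat !IH.
Qed.

Lemma path_halve delta n a b : 0 <= a -> a < b -> b <= 1 ->
  b - a < delta * 2 ^+ n -> path (fine_step delta) a (halve n a b).
Proof.
elim: n a b => [|n IH] a b a0 ab b1 /=.
  by rewrite mulr1 andbT => h; apply/and4P; split.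
rewrite exprS => h; rewrite cat_path last_halve !IH//; lra.
Qed.

Fixpoint refine_partition n a s : seq R :=
  if s is b :: s' then halve n a b ++ refine_partition n b s' else [::].

Lemma last_refine n a s : last a (refine_partition n a s) = last a s.
Proof. by elim: s a => [//|b s IH] a /=; rewrite last_cat last_halve IH. Qed.

Lemma path_refine delta delta' n a s : path (fine_step delta') a s ->
  1 < delta * 2 ^+ n -> path (fine_step delta) a (refine_partition n a s).
Proof.
move=> + h; elim: s a => [//|b s IH] a /= /andP[/and4P[a0 ab b1 _] ps].
by rewrite cat_path last_halve IH// andbT path_halve//; lra.
Qed.

Lemma near_halving delta : 0 < delta ->
  \forall n \near \oo, 1 < delta * 2 ^+ n.
Proof.
move=> d0; have /cvgrPdist_lt/(_ _ d0) : (2 ^- n : R) @[n --> \oo] --> (0 : R).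
  by under eq_fun do rewrite -exprVn; apply: cvg_expr; rewrite ger0_norm; lra.
apply: filterS => n; rewrite sub0r normrN ger0_norm ?invr_ge0 ?exprn_ge0//.
by rewrite -div1r ltr_pdivrMr ?exprn_gt0.
Qed.

(** A discrete intermediate value theorem: m is the first point of s where V reaches the level h.
    The step into m, which straddles the level, stays outside both pieces. *)
Lemma split_at_level delta (V : R -> R) h a s : path (fine_step delta) a s ->
  s != [::] -> V a <= h -> h <= V (last a s) ->
  exists s1 m s2, [/\ s = s1 ++ m :: s2, V (last a s1) <= h & h <= V m].
Proof.
elim: s a => [//|b [|b' s] IH] a /= /andP[ab ps] _ ah hl.
  by exists [::], b, [::]; split.
have [hb|/ltW bh] := leP h (V b); first by exists [::], b, (b' :: s); split.
have [s1 [m [s2 [-> ? ?]]]] := IH b ps isT bh hl.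
by exists (b :: s1), m, s2; split.
Qed.

End partitions.

(** * Measurability and areas in the plane *)

Section plane_measurability.
Context {R : realType}.

(** The measurable sets here are those of the product sigma-algebra; an open set is a countable
    union of boxes with rational corners. *)
Lemma open_measurable_plane (A : set (R * R)) : open A -> measurable A.
Proof.
move=> oA.
pose box (p q p' q' : rat) : set (R * R) :=
  `]ratr p, ratr q[%classic `*` `]ratr p', ratr q'[%classic.
have -> : A = \bigcup_p \bigcup_q \bigcup_p' \bigcup_q'
    (if `[< box p q p' q' `<=` A >] then box p q p' q' else set0).
  apply/seteqP; split => [z Az|z]; last first.
    by move=> [p _ [q _ [p' _ [q' _]]]]; case: ifPn => // /asboolP; exact.
  have /nbhs_ballP[e /= e0 zeA] : nbhs z A by exact: open_nbhs_nbhs.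
  have lo (x : R) : x - e < x by lra.
  have hi (x : R) : x < x + e by lra.
  have [p] := rat_in_itvoo (lo z.1); rewrite in_itv/= => /andP[p1 p2].
  have [q] := rat_in_itvoo (hi z.1); rewrite in_itv/= => /andP[q1 q2].
  have [p'] := rat_in_itvoo (lo z.2); rewrite in_itv/= => /andP[p1' p2'].
  have [q'] := rat_in_itvoo (hi z.2); rewrite in_itv/= => /andP[q1' q2'].
  exists p => //; exists q => //; exists p' => //; exists q' => //.
  rewrite ifT; first by split; rewrite /= in_itv/=; apply/andP.
  apply/asboolP => w [/=]; rewrite !in_itv/= => /andP[w1 w2] /andP[w3 w4].
  by apply: zeA; split; rewrite /ball/= ltr_distlC; apply/andP; split; lra.
do 4![apply: bigcupT_measurable_rat => ?].
case: ifPn => // _; apply: measurableX; exact: measurable_itv.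
Qed.

Lemma continuous_measurable_plane (h : R * R -> R) :
  continuous h -> measurable_fun setT h.
Proof.
move=> /continuousP ch; apply: (measurability _ (RGenOpens.measurableE R)).
move=> _ [_ [a [b ->] <-]]; rewrite setTI.
by apply: open_measurable_plane; apply: ch; exact: interval_open.
Qed.

Definition step (x u : R) : R := (u < x)%R%:R.

Lemma measurable_step1 x : measurable_fun setT (fun z : R * R => step x z.1).
Proof.
rewrite [X in measurable_fun _ X](_ : _ = \1_(`]-oo, x[%classic) \o fst).
  by apply: measurableT_comp => //; exact: measurable_indic.
by apply/funext => z; rewrite /= indicE mem_setE in_itv.
Qed.

Lemma measurable_step2 y : measurable_fun setT (fun z : R * R => step y z.2).
Proof.
rewrite [X in measurable_fun _ X](_ : _ = \1_(`]-oo, y[%classic) \o snd).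
  by apply: measurableT_comp => //; exact: measurable_indic.
by apply/funext => z; rewrite /= indicE mem_setE in_itv.
Qed.

Lemma measurable_csum (c : R -> R -> R * R -> R) a s :
  (forall a b, measurable_fun setT (c a b)) ->
  measurable_fun setT (fun z => csum (fun a b => c a b z) a s).
Proof.
move=> mc; elim: s a => [|b s IH] a /=; first exact: measurable_cst.
by apply: measurable_funD.
Qed.

End plane_measurability.

(** * The L^1 norm on the plane *)

Section L1norm.
Context {R : realType}.
Notation mu2 := (@lebesgue_measure R \x @lebesgue_measure R)%E.

Definition L1norm (f : R * R -> R) : \bar R := (\int[mu2]_z `|f z|%:E)%E.

Lemma L1normD (f g : R * R -> R) : measurable_fun setT f -> measurable_fun setT g ->
  (L1norm (fun z => f z + g z)%R <= L1norm f + L1norm g)%E.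
Proof.
move=> mf mg; rewrite /L1norm -ge0_integralD//; last 2 first.
- by apply/measurable_EFinP; exact: measurableT_comp.
- by apply/measurable_EFinP; exact: measurableT_comp.
apply: ge0_le_integral => //.
- by apply/measurable_EFinP; apply: measurableT_comp => //; exact: measurable_funD.
- by apply: emeasurable_funD; apply/measurable_EFinP; exact: measurableT_comp.
- by move=> z _; rewrite -EFinD lee_fin ler_normD.
Qed.

Lemma L1norm0 : L1norm (fun=> 0) = 0%E.
Proof. by rewrite /L1norm normr0 integral0. Qed.

Lemma norm_stepB (x x' u : R) :
  `|step x u - step x' u| = \1_(`[Num.min x x', Num.max x x'[%classic) u.
Proof.
rewrite indicE mem_setE in_itv/= /step.
have [xx'|xx'] := leP x x'; have [ux|ux] := ltP u x; have [ux'|ux'] := ltP u x';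
  rewrite /= ?subrr ?subr0 ?sub0r ?normr0 ?normrN ?normr1 //; lra.
Qed.

Lemma lebesgue_measure_minmax (x x' : R) :
  lebesgue_measure `[Num.min x x', Num.max x x'[%classic = `|x - x'|%:E.
Proof.
rewrite lebesgue_measure_itv/= lte_fin.
have [xx'|xx'] := leP x x'; last first.
  by rewrite xx' -EFinD gtr0_norm// subr_gt0.
rewrite lt_neqAle xx' andbT; case: eqVneq => [->|_] /=.
  by rewrite subrr normr0.
by rewrite -EFinD distrC ger0_norm// subr_ge0.
Qed.

(** Up to sign the function is the indicator of the half-open rectangle with opposite corners (x, y)
    and (x', y'). The L^1 estimates for staircases and corners reduce to this area. *)
Lemma L1norm_rect (x x' y y' : R) :
  L1norm (fun z => (step x z.1 - step x' z.1) * (step y z.2 - step y' z.2)) =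
  (`|x - x'| * `|y - y'|)%:E.
Proof.
rewrite /L1norm.
transitivity (\int[mu2]_z (\1_(`[Num.min x x', Num.max x x'[%classic `*`
   `[Num.min y y', Num.max y y'[%classic) z)%:E)%E.
  apply: eq_integral => z _; congr (_%:E).
  rewrite normrM !norm_stepB -natrM mulnb; congr (_%:R); congr nat_of_bool.
  by rewrite in_setX.
rewrite integral_indic//; last by apply: measurableX; exact: measurable_itv.
rewrite setIT; apply: (etrans (product_measure1E _ _ _ _)); try exact: measurable_itv.
by rewrite EFinM; congr (_ * _)%E; exact: lebesgue_measure_minmax.
Qed.

End L1norm.

(** Write u^al = u u^(al - 1) and bound both second factors by (x + y)^(al - 1). This is what sums
    local bounds (V b - V a)^al over consecutive intervals. *)
Lemma powR_superadditive {R : realType} (x y al : R) : 0 <= x -> 0 <= y ->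
  1 <= al -> x `^ al + y `^ al <= (x + y) `^ al.
Proof.
move=> x0 y0 al1.
have powE (u : R) : 0 <= u -> u `^ al = u * u `^ (al - 1).
  by move=> u0; rewrite mulr_powRB1//; lra.
rewrite !powE ?addr_ge0// mulrDl lerD// ler_wpM2l// ge0_ler_powR ?nnegrE//; lra.
Qed.

(** * Staircase winding functions and the sewing bound *)

Section staircase.
Context {R : realType}.
Implicit Types (X Y V Z : R -> R) (a b : R) (s t : seq R) (z : R * R).

Definition stair_step X Y a b z : R :=
  step (X a) z.1 * (step (Y b) z.2 - step (Y a) z.2).

(* For [a = 0] this is the function w_s of the introduction. *)
Definition stair X Y a s z : R := csum (fun b c => stair_step X Y b c z) a s.

(** The effect of inserting the inner points of s into the single step from a to the last point. *)
Definition stair_defect X Y a s z : R :=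
  stair X Y a s z - stair_step X Y a (last a s) z.

Lemma measurable_stair_step X Y a b : measurable_fun setT (stair_step X Y a b).
Proof.
apply: measurable_funM; first exact: measurable_step1.
by apply: measurable_funB; exact: measurable_step2.
Qed.

Lemma measurable_stair X Y a s : measurable_fun setT (stair X Y a s).
Proof. by apply: measurable_csum => *; exact: measurable_stair_step. Qed.

Lemma measurable_stair_defect X Y a s :
  measurable_fun setT (stair_defect X Y a s).
Proof.
apply: measurable_funB; [exact: measurable_stair|exact: measurable_stair_step].
Qed.

(** Squares are bounded because the quantities to control are areas |dx| |dy|. V plays the role of a
    control function, and E can be made small at the cost of a small delta
    ([exists_small_control]). *)
Definition small_variation Z V (E al delta : R) : Prop :=
  forall a b, 0 <= a -> a <= b -> b <= 1 -> b - a < delta ->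
  (Z b - Z a) ^+ 2 <= E * (V b - V a) `^ al.

(** * Young's bisection argument *)

Section sewing.
Context (X Y V : R -> R) (E al K delta : R).
Hypothesis ndV : forall a b, 0 <= a -> a <= b -> b <= 1 -> V a <= V b.
Hypothesis E0 : 0 <= E.
Hypothesis al1 : 1 <= al.
Hypothesis hX : small_variation X V E al delta.
Hypothesis hY : small_variation Y V E al delta.
Hypothesis K0 : 0 <= K.
Hypothesis hK : 2 * 2^-1 `^ al * K + 2 <= K.

Lemma powR_controlW a b c d : 0 <= a -> a <= b -> b <= c -> c <= d -> d <= 1 ->
  (V c - V b) `^ al <= (V d - V a) `^ al.
Proof.
move=> a0 ab bc cd d1.
have Vab : V a <= V b by apply: ndV => //; lra.
have Vbc : V b <= V c by apply: ndV => //; lra.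
have Vcd : V c <= V d by apply: ndV => //; lra.
by apply: ge0_ler_powR; rewrite ?nnegrE; [exact: le_trans ler01 al1|lra..].
Qed.

(** Both squared increments are at most the right-hand side, and 2 u v <= u^2 + v^2. *)
Lemma small_variationM a b c d e f : 0 <= a -> f <= 1 -> f - a < delta ->
  a <= b -> b <= c -> c <= f -> a <= d -> d <= e -> e <= f ->
  `|X c - X b| * `|Y e - Y d| <= E * (V f - V a) `^ al.
Proof.
move=> a0 f1 fa ab bc cf ad de ef.
have x2 : `|X c - X b| ^+ 2 <= E * (V f - V a) `^ al.
  rewrite -normrX ger0_norm ?sqr_ge0//.
  apply: (@le_trans _ _ (E * (V c - V b) `^ al)); first by apply: hX; lra.
  by rewrite ler_wpM2l// powR_controlW//; lra.
have y2 : `|Y e - Y d| ^+ 2 <= E * (V f - V a) `^ al.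
  rewrite -normrX ger0_norm ?sqr_ge0//.
  apply: (@le_trans _ _ (E * (V e - V d) `^ al)); first by apply: hY; lra.
  by rewrite ler_wpM2l// powR_controlW//; lra.
have := sqr_ge0 (`|X c - X b| - `|Y e - Y d|); lra.
Qed.

(* Bisecting at the level (V a + V b) / 2 leaves two shorter partitions whose
   control is at most half of the total one; as [al > 1] the resulting recursive
   bound closes up with a constant independent of the partition. *)
Lemma stair_defect_le a s : 0 <= a -> path (fine_step delta) a s ->
  last a s - a < delta ->
  (L1norm (stair_defect X Y a s) <=
   (K * (E * (V (last a s) - V a) `^ al))%:E)%E.
Proof.
have [n] := ubnP (size s); elim: n s a => [//|n IH] s a.
have [-> _ _ _ _|s0] := eqVneq s [::].
  rewrite (_ : stair_defect X Y a [::] = fun=> 0); last first.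
    by apply/funext => z; rewrite /stair_defect /stair /stair_step/= subrr mulr0 subrr.
  by rewrite L1norm0 lee_fin mulr_ge0// mulr_ge0// powR_ge0.
move=> sn a0 ps la.
have l1 : last a s <= 1.
  case: s s0 {la sn} ps => // b s _ /= /andP[/and4P[_ _ b1 _]].
  exact: path_last_le1.
have al_le := path_last_ge ps.
have Val : V a <= V (last a s) by exact: ndV.
set W := V (last a s) - V a.
have [||s1 [m [s2 [sE V1 V2]]]] := @split_at_level _ _ V (V a + W / 2) _ _ ps s0;
  [by rewrite /W; lra|by rewrite /W; lra|].
move: (ps); rewrite sE cat_path/= => /and3P[ps1 /and4P[j0 jm m1 _] ps2].
set j := last a s1 in j0 jm V1.
have aj : a <= j := path_last_ge ps1.
have lE : last a s = last m s2 by rewrite sE last_cat.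
have ml : m <= last a s by rewrite lE; exact: path_last_ge ps2.
move: sn; rewrite sE size_cat/= addnS ltnS => sn.
have half w : 0 <= w -> w <= W / 2 -> w `^ al <= W `^ al * 2^-1 `^ al.
  move=> w0 wW; rewrite -powRM ?invr_ge0//; last by rewrite /W; lra.
  by apply: ge0_ler_powR; rewrite ?nnegrE; [exact: le_trans ler01 al1|rewrite /W in wW *; lra..].
have B1 : (L1norm (stair_defect X Y a s1) <=
    (K * (E * (W `^ al * 2^-1 `^ al)))%:E)%E.
  apply: le_trans (IH _ _ _ _ ps1 _) _ => //.
  - by rewrite (leq_ltn_trans _ sn)// leq_addr.
  - by rewrite -/j; lra.
  - rewrite lee_fin ler_wpM2l// ler_wpM2l// half// -/j ?subr_ge0 ?ndV//; lra.
have B2 : (L1norm (stair_defect X Y m s2) <=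
    (K * (E * (W `^ al * 2^-1 `^ al)))%:E)%E.
  apply: le_trans (IH _ _ _ _ ps2 _) _ => //.
  - by rewrite (leq_ltn_trans _ sn)// leq_addl.
  - lra.
  - by rewrite -lE; lra.
  - rewrite -lE lee_fin ler_wpM2l// ler_wpM2l// half// ?subr_ge0 ?ndV//; rewrite /W in V2 *; lra.
(* Once both pieces are reduced to single steps, the points a, j, m and the last one remain.
   Removing j costs the rectangle [g1], and then removing m costs [g2]. *)
pose g1 z := (step (X j) z.1 - step (X a) z.1) * (step (Y m) z.2 - step (Y j) z.2).
pose g2 z := (step (X m) z.1 - step (X a) z.1) *
             (step (Y (last a s)) z.2 - step (Y m) z.2).
have B3 : (L1norm g1 <= (E * W `^ al)%:E)%E.
  by rewrite L1norm_rect lee_fin; apply: small_variationM; lra.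
have B4 : (L1norm g2 <= (E * W `^ al)%:E)%E.
  by rewrite L1norm_rect lee_fin; apply: small_variationM; lra.
have mstep x x' y y' : measurable_fun setT (fun z : R * R =>
    (step x z.1 - step x' z.1) * (step y z.2 - step y' z.2)).
  by apply: measurable_funM; apply: measurable_funB;
    do ?[exact: measurable_step1|exact: measurable_step2].
have -> : stair_defect X Y a (s1 ++ m :: s2) = fun z =>
    (stair_defect X Y a s1 z + stair_defect X Y m s2 z) + (g1 z + g2 z).
  apply/funext => z; rewrite /stair_defect last_cat/= -lE /g1 /g2 /stair csum_cat/= -/j.
  rewrite /stair_step; ring.
apply: le_trans (L1normD _ _) _.
- by apply: measurable_funD; exact: measurable_stair_defect.
- by apply: measurable_funD; exact: mstep.
apply: (@le_trans _ _ ((K * (E * (W `^ al * 2^-1 `^ al)))%:E +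
   (K * (E * (W `^ al * 2^-1 `^ al)))%:E + ((E * W `^ al)%:E + (E * W `^ al)%:E))%E).
  apply: leeD.
    apply: le_trans (L1normD _ _) _; [exact: measurable_stair_defect..|].
    exact: leeD.
  apply: le_trans (L1normD _ _) _; [exact: mstep..|exact: leeD].
rewrite -!EFinD lee_fin.
have EW : 0 <= E * W `^ al by rewrite mulr_ge0// powR_ge0.
(* The two halves contribute 2 * 2^-al K and the two rectangles 2, in units of E W^al; [hK] absorbs
   them into K. *)
have := ler_wpM2r EW hK.
set p2 := 2^-1 `^ al; set e := W `^ al; move=> h.
have -> : K * (E * (e * p2)) + K * (E * (e * p2)) + (E * e + E * e) =
  (2 * p2 * K + 2) * (E * e) by ring.
by rewrite (le_trans h).
Qed.

(** Refining one step changes the staircase by a [stair_defect]; the bounds for the separate steps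
    add up by superadditivity, uniformly in n. *)
Lemma stair_refine_le n a s : 0 <= a -> a <= 1 -> path (fine_step delta) a s ->
  (L1norm (fun z => stair X Y a (refine_partition n a s) z - stair X Y a s z)%R <=
   (K * (E * (V (last a s) - V a) `^ al))%:E)%E.
Proof.
elim: s a => [|b s IH] a a0 a1 ps.
  rewrite (_ : (fun _ => _) = fun=> 0); last by apply/funext => z; rewrite subrr.
  by rewrite L1norm0 lee_fin mulr_ge0// mulr_ge0// powR_ge0.
move: ps => /= /andP[/and4P[_ ab b1 bd] ps].
have -> : (fun z => stair X Y a (halve n a b ++ refine_partition n b s) z -
    stair X Y a (b :: s) z) = (fun z => stair_defect X Y a (halve n a b) z +
      (stair X Y b (refine_partition n b s) z - stair X Y b s z)).
  apply/funext => z; rewrite /stair_defect /stair csum_cat/= last_halve; ring.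
apply: le_trans (L1normD _ _) _.
- exact: measurable_stair_defect.
- by apply: measurable_funB; exact: measurable_stair.
apply: le_trans (leeD (stair_defect_le _ _ _) (IH _ _ _ _)) _ => //.
- apply: path_halve => //; rewrite (lt_le_trans bd)// ler_peMr//; first lra.
  by rewrite exprn_ege1//; lra.
- by rewrite last_halve.
- lra.
rewrite last_halve -EFinD lee_fin -mulrDr ler_wpM2l// -mulrDr ler_wpM2l//.
have bl := path_last_ge ps; have l1 := path_last_le1 b1 ps.
apply: le_trans (powR_superadditive _ _ _) _ => //.
- by rewrite subr_ge0 ndV//; lra.
- by rewrite subr_ge0 ndV//; lra.
by rewrite addrC addrA subrK.
Qed.

Lemma csum_powR_le a s : 0 <= a -> a <= 1 -> path (fine_step delta) a s ->
  csum (fun b c => (V c - V b) `^ al) a s <= (V (last a s) - V a) `^ al.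
Proof.
elim: s a => [|b s IH] a a0 a1; first by rewrite /= powR_ge0.
move=> /= /andP[/and4P[_ ab b1 bd] ps].
have bl := path_last_ge ps; have l1 := path_last_le1 b1 ps.
apply: le_trans (lerD (lexx _) (IH b _ _ ps)) _; try lra.
apply: le_trans (powR_superadditive _ _ _) _ => //.
- by rewrite subr_ge0 ndV//; lra.
- by rewrite subr_ge0 ndV//; lra.
by rewrite addrC addrA subrK.
Qed.

End sewing.

(** As al > 1, the factor 2 * 2^-al is below 1, so the affine recursion of the bisection has the
    fixed point 2 / (1 - 2 * 2^-al). *)
Lemma sewing_constant (al : R) : 1 < al ->
  exists2 K, 0 <= K & 2 * 2^-1 `^ al * K + 2 <= K.
Proof.
move=> al1; set p2 := 2^-1 `^ al.
have h : 2 * p2 < 1.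
  rewrite /p2 -mulr_powRB1 ?invr_ge0//; last by lra.
  have al0 : 0 < al - 1 by lra.
  have := @gt0_ltr_powR R _ al0 2^-1 1; rewrite !nnegrE powR1 mulrA mulfV// mul1r.
  by apply; lra.
have p20 : 0 <= p2 := powR_ge0 _ _.
have d0 : 0 < 1 - 2 * p2 by lra.
exists (2 / (1 - 2 * p2)); first by rewrite divr_ge0//; lra.
rewrite -lerBrDl -[X in X - _]mul1r -mulrBl mulrCA divff ?mulr1//.
by rewrite gt_eqF.
Qed.

End staircase.

(** * Crossings and angles *)

Section angle.
Context {R : realType}.
Implicit Types (th r : R) (m : int).

(** The index m of the window ]2 pi (m - 1), 2 pi m] containing th. The ceiling matches the strict
    inequality in [step]: at th = 2 pi m the sine vanishes, and th is grouped with the angles just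
    below it. *)
Definition turn th : int := Num.ceil (th / (2 * pi)).

Lemma periodicz (f : R -> R) (T : R) : periodic f T ->
  forall (m : int) a, f (a + T *~ m) = f a.
Proof.
move=> fT [n|n] a; first exact: periodicn fT n a.
by rewrite NegzE mulrNz -[X in _ = f X](subrK (T *+ n.+1) a) (periodicn fT).
Qed.

Lemma sin_turn (th : R) (m : int) : sin (th + m%:~R * (2 * pi)) = sin th.
Proof. by rewrite mulrC mulr_natl mulrzr (periodicz (@sinD2pi R)). Qed.

Lemma cos_turn (th : R) (m : int) : cos (th + m%:~R * (2 * pi)) = cos th.
Proof. by rewrite mulrC mulr_natl mulrzr (periodicz (@cosD2pi R)). Qed.

(** r is the angle reduced to ]0, 2 pi], and the signs of sine and cosine locate it among the
    quadrants. This turns the trigonometry of [step_turn] into linear arithmetic. *)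
Lemma turnP th : exists r, [/\ th = r + (turn th - 1)%:~R * (2 * pi),
  0 < r <= 2 * pi,
  (if 0 < sin th then r < pi else pi <= r),
  (0 < cos th -> if 0 < sin th then r < pi / 2 else 3 * pi / 2 < r) &
  (cos th < 0 -> if 0 < sin th then pi / 2 < r else r < 3 * pi / 2)].
Proof.
have pi0 := pi_gt0 R; pose r := th - (turn th - 1)%:~R * (2 * pi).
have thE : th = r + (turn th - 1)%:~R * (2 * pi) by rewrite /r subrK.
have pi20 : 0 < 2 * pi :> R by lra.
have r02 : 0 < r <= 2 * pi.
  have /andP[] := ceil_itv (th / (2 * pi)); rewrite -/(turn th).
  rewrite ltr_pdivlMr// ler_pdivrMr// => h1 h2; rewrite /r; apply/andP; split; first lra.
  by rewrite rmorphB/=; lra.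
exists r; rewrite [in sin th]thE [in cos th]thE sin_turn cos_turn.
have /andP[r0 r2] := r02.
split=> //.
- have [sr|sr] := ltP 0 (sin r).
    rewrite ltNge; apply/negP => pr; move: sr; rewrite ltNge => /negP; apply.
    have -> : r = (r - pi) + pi by rewrite subrK.
    by rewrite sinDpi oppr_le0 sin_ge0_pi//; lra.
  by rewrite leNgt; apply/negP => rp; move: sr; rewrite leNgt sin_gt0_pi//; lra.
- move=> cr; have [sr|sr] := ltP 0 (sin r).
    have rp : r < pi.
      rewrite ltNge; apply/negP => pr; move: sr; rewrite ltNge => /negP; apply.
      have -> : r = (r - pi) + pi by rewrite subrK.
      by rewrite sinDpi oppr_le0 sin_ge0_pi//; lra.
    rewrite ltNge; apply/negP => pr; move: cr; rewrite ltNge => /negP; apply.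
    have -> : r = (r - pi / 2) + pi / 2 by rewrite subrK.
    by rewrite cosDpihalf oppr_le0 sin_ge0_pi//; lra.
  have pr : pi <= r.
    by rewrite leNgt; apply/negP => rp; move: sr; rewrite leNgt sin_gt0_pi//; lra.
  rewrite ltNge; apply/negP => rp; move: cr; rewrite ltNge => /negP; apply.
  have -> : r = (r - pi) + pi by rewrite subrK.
  by rewrite cosDpi oppr_le0 cos_ge0_pihalf//; lra.
- move=> cr; have [sr|sr] := ltP 0 (sin r).
    rewrite ltNge; apply/negP => pr; move: cr; rewrite ltNge => /negP; apply.
    by rewrite cos_ge0_pihalf//; lra.
  rewrite ltNge; apply/negP => rp; move: cr; rewrite ltNge => /negP; apply.
  have -> : r = (r - 2 * pi) + 2 * pi by rewrite subrK.
  by rewrite mulr_natl cosD2pi cos_ge0_pihalf//; rewrite -mulr_natl; lra.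
Qed.

Lemma int_eq_of_near (m n k : int) : - 1 < (m - n - k)%:~R :> R ->
  (m - n - k)%:~R < 1 :> R -> m - n = k.
Proof.
move=> h1 h2; have : - 1 < m - n - k by rewrite -(ltr_int R).
have : m - n - k < 1 by rewrite -(ltr_int R).
lia.
Qed.

(* A crossing of the positive horizontal axis is exactly what moves the angle
   into another window ]2 pi (m - 1), 2 pi m]. *)
Lemma step_turn th th' : `|th' - th| < pi ->
  ((0 < sin th) != (0 < sin th') ->
    (0 < cos th /\ 0 < cos th') \/ (cos th < 0 /\ cos th' < 0)) ->
  (0 < cos th)%R%:R * ((0 < sin th')%R%:R - (0 < sin th)%R%:R) =
  (turn th' - turn th)%:~R :> R.
Proof.
move=> /ltr_normlP[d1 d2] hc; have pi0 := pi_gt0 R.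
have [r [thE /andP[r0 r2] rs rc rc']] := turnP th.
have [q [thE' /andP[q0 q2] qs qc qc']] := turnP th'.
have pi20 : 0 < 2 * pi :> R by lra.
(* The quantity th' - th - (q - r) is 2 pi times the difference of the turns, an integer, so an
   estimate to within less than one turn determines it. *)
have win k : - (2 * pi) < th' - th - (q - r) - k%:~R * (2 * pi) ->
    th' - th - (q - r) - k%:~R * (2 * pi) < 2 * pi -> turn th' - turn th = k.
  have -> : th' - th - (q - r) - k%:~R * (2 * pi) =
      (turn th' - turn th - k)%:~R * (2 * pi).
    by rewrite [in LHS]thE [in LHS]thE' !rmorphB/=; ring.
  rewrite -mulN1r ltr_pM2r// -[X in _ -> _ < X -> _]mul1r ltr_pM2r//.
  exact: int_eq_of_near.
have [sth|sth] := boolP (0 < sin th); have [sth'|sth'] := boolP (0 < sin th');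
  rewrite ?sth ?sth' ?(negbTE sth) ?(negbTE sth') /= in rs rc rc' qs qc qc' hc *.
- rewrite subrr mulr0 (win 0) ?mul0r//; lra.
- have [[c c']|[c c']] := hc isT; have := rc; have := rc'; have := qc; have := qc'.
    move=> _ /(_ c') h _ /(_ c) h'; rewrite c mul1r sub0r (win (-1)) ?mulN1r//; lra.
  move=> /(_ c') h _ /(_ c) h' _; rewrite [0 < cos th]lt_gtF// mul0r (win 0) ?mul0r//; lra.
- have [[c c']|[c c']] := hc isT; have := rc; have := rc'; have := qc; have := qc'.
    move=> _ /(_ c') h _ /(_ c) h'; rewrite c mul1r subr0 (win 1) ?mul1r//; lra.
  move=> /(_ c') h _ /(_ c) h' _; rewrite [0 < cos th]lt_gtF// mul0r (win 0) ?mul0r//; lra.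
- rewrite subrr mulr0 (win 0) ?mul0r//; lra.
Qed.

End angle.

(** * Winding numbers of curves *)

Section curves.
Context {R : realType}.

(** Heine's theorem: continuity at x gives a modulus valid for all points near x, and compactness,
    in its covering form, makes it uniform. *)
Lemma segment_unif_continuous (V : normedModType R) (f : R -> V) (e : R) :
  {within `[0, 1], continuous f} -> 0 < e ->
  exists2 d, 0 < d & forall a b, 0 <= a <= 1 -> 0 <= b <= 1 ->
    `|b - a| < d -> `|f b - f a| < e.
Proof.
move=> cf e0.
have cK : compact (`[0, 1]%classic : set R) by exact: segment_compact.
pose P (d t : R) := 0 <= t <= 1 -> forall b, 0 <= b <= 1 -> `|b - t| < d ->
  `|f b - f t| < e.
have near_cK := (compact_near_coveringP _).1 cK.
have H : forall x : R, `[0, 1]%classic x -> \forall x' \near x & d \near 0^'+, P d x'.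
  move=> x; rewrite /= in_itv/= => x01.
  have e2 : 0 < e / 2 by rewrite divr_gt0.
  have /cvgrPdist_lt/(_ _ e2) fx := cf x.
  have x01' : `[0, 1]%classic x by rewrite /= in_itv.
  have : within `[0, 1] (nbhs x) [set t | `|f x - f t| < e / 2].
    by rewrite (nbhs_subspace_in x01'); exact: fx.
  rewrite /within/= => /nbhs_ballP[r /= r0 hr].
  have near01 (t : R) : 0 <= t <= 1 -> `|x - t| < r -> `|f x - f t| < e / 2.
    by move=> t01 xt; apply: (hr t xt); rewrite /= in_itv.
  exists (ball x (r / 2), [set d | d < r / 2]).
    split; first by apply: nbhsx_ballx; rewrite divr_gt0.
    by apply: nbhs_right_lt; rewrite divr_gt0.
  move=> [t d] /= [xt dr] t01 b b01 bt.
  have h1 : `|f x - f t| < e / 2.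
    by apply: near01 => //; rewrite (lt_trans xt)//; lra.
  have h2 : `|f x - f b| < e / 2.
    apply: near01 => //; rewrite (_ : x - b = (x - t) - (b - t)); last by ring.
    by rewrite (le_lt_trans (ler_normB _ _))//; rewrite /ball/= in xt; lra.
  rewrite (_ : f b - f t = (f x - f t) - (f x - f b)); last first.
    by rewrite opprB [RHS]addrC addrA subrK.
  by rewrite (le_lt_trans (ler_normB _ _))//; lra.
have [d /= d0 hd] := near_cK R ((0 : R)^'+) P _ H.
exists (d / 2); first by rewrite divr_gt0.
move=> a b a01 b01 ab; apply: (hd (d / 2)) => //=.
  by rewrite sub0r normrN gtr0_norm ?divr_gt0//; lra.
by rewrite divr_gt0.
Qed.

Context (gamma : R -> R * R).
Hypothesis cgamma : {within `[0, 1], continuous gamma}.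
Let X t := (gamma t).1.
Let Y t := (gamma t).2.

Lemma norm_plane_lt (z w : R * R) (e : R) :
  `|z - w| < e <-> `|z.1 - w.1| < e /\ `|z.2 - w.2| < e.
Proof. by rewrite prod_normE/= gt_max; split => [/andP[]|[-> ->]]. Qed.

Lemma curve_unif_continuous (e : R) : 0 < e -> exists2 d, 0 < d &
  forall a b, 0 <= a <= 1 -> 0 <= b <= 1 -> `|b - a| < d ->
    `|X b - X a| < e /\ `|Y b - Y a| < e.
Proof.
move=> e0; have [d d0 hd] := segment_unif_continuous cgamma e0.
by exists d => // a b a01 b01 ab; apply/norm_plane_lt/hd.
Qed.

Lemma fine_step_close (e d : R) :
  (forall a b, 0 <= a <= 1 -> 0 <= b <= 1 -> `|b - a| < d ->
    `|X b - X a| < e /\ `|Y b - Y a| < e) ->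
  forall a b, fine_step d a b -> `|X b - X a| < e /\ `|Y b - Y a| < e.
Proof.
move=> h a b /and4P[a0 ab b1 bad]; apply: h; [lra|lra|].
by rewrite ger0_norm ?subr_ge0// ltW.
Qed.

(** Distance at least d from the curve in the max norm. The disjunction tells which coordinate is
    far, hence which of the two factors of a stair term is under control. *)
Definition separated_from_curve (z : R * R) (d : R) :=
  forall t, 0 <= t <= 1 -> d <= `|X t - z.1| \/ d <= `|Y t - z.2|.

Lemma compact_curve_image : compact (curve_image gamma).
Proof. by apply: continuous_compact => //; exact: segment_compact. Qed.

Lemma closed_curve_image : closed (curve_image gamma).
Proof. by apply: compact_closed compact_curve_image; exact: norm_hausdorff. Qed.

Lemma off_curve_separated z : ~ curve_image gamma z ->
  exists2 d, 0 < d & separated_from_curve z d.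
Proof.
move=> nz; have : nbhs z (~` curve_image gamma).
  by apply: open_nbhs_nbhs; split => //; exact/closed_openC/closed_curve_image.
move=> /nbhs_ballP[d /= d0 zd]; exists d => // t t01.
have [h1|h1] := leP d `|X t - z.1|; first by left.
have [h2|h2] := leP d `|Y t - z.2|; first by right.
exfalso; apply: (zd (gamma t)); last by exists t => //=; rewrite in_itv.
by split; rewrite /ball/= distrC.
Qed.

Lemma curve_bounded : exists2 M, 0 < M &
  forall t, 0 <= t <= 1 -> `|X t| < M /\ `|Y t| < M.
Proof.
have [M0 [_ hM]] := compact_bounded compact_curve_image.
exists (`|M0| + 1); first by rewrite ltr_pwDr.
move=> t t01; have /hM : M0 < `|M0| + 1 / 2 by rewrite (le_lt_trans (ler_norm _))// ltrDl.
have it : curve_image gamma (gamma t) by exists t => //=; rewrite in_itv.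
move=> /(_ _ it) /=; rewrite prod_normE ge_max => /andP[h1 h2].
by split; rewrite /X /Y; lra.
Qed.

(** Seen from z, a stair term records a signed crossing of the right horizontal half-line. By
    [step_turn] it is the change of [turn] of the argument, so the sum telescopes to k. *)
Lemma stair_winding z (k : int) : ~ curve_image gamma z ->
  has_winding_number gamma z k -> exists2 d, 0 < d &
  forall s, path (fine_step d) 0 s -> last 0 s = 1 -> stair X Y 0 s z = k%:~R.
Proof.
move=> /off_curve_separated[e e0 se] [rho [th [cth hth th10]]].
have [d1 d10 hd1] := curve_unif_continuous e0.
have [d2 d20 hd2] := segment_unif_continuous cth (pi_gt0 R).
(* [d1] keeps each step shorter than the distance from z to the curve, and [d2] keeps the change of
   the angle below pi. *)
exists (Num.min d1 d2); first by rewrite lt_min d10.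
move=> s ps ls.
have XE t : 0 <= t <= 1 -> X t = z.1 + rho t * cos (th t).
  by move=> /hth[_]; rewrite /X => ->.
have YE t : 0 <= t <= 1 -> Y t = z.2 + rho t * sin (th t).
  by move=> /hth[_]; rewrite /Y => ->.
have sX t : 0 <= t <= 1 -> step (X t) z.1 = (0 < cos (th t))%R%:R.
  by move=> t01; rewrite /step XE// ltrDl pmulr_rgt0//; case: (hth _ t01).
have sY t : 0 <= t <= 1 -> step (Y t) z.2 = (0 < sin (th t))%R%:R.
  by move=> t01; rewrite /step YE// ltrDl pmulr_rgt0//; case: (hth _ t01).
rewrite /stair (eq_csum (d := fun a b => (turn (th b))%:~R - (turn (th a))%:~R) ps).
  rewrite (csum_telescope (fun t => (turn (th t))%:~R)) ls /turn.
  have -> : th 1 = th 0 + 2 * pi * k%:~R by rewrite -th10 addrC subrK.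
  rewrite mulrDl [2 * pi * _]mulrC mulfK; last first.
    by rewrite mulf_neq0// gt_eqF// pi_gt0.
  by rewrite ceilDrz ?intr_int// intrKceil rmorphD/= addrC addKr.
move=> a b /and4P[a0 ab b1 bad].
have a01 : 0 <= a <= 1 by lra.
have b01 : 0 <= b <= 1 by lra.
have bad' : `|b - a| < Num.min d1 d2 by rewrite gtr0_norm ?subr_gt0.
move: bad'; rewrite lt_min => /andP[bd1 bd2].
rewrite /stair_step sX// !sY// step_turn ?rmorphB//; first exact: hd2.
move=> sgn; have [dX dY] := hd1 _ _ a01 b01 bd1.
have [ra _] := hth _ a01; have [rb _] := hth _ b01.
have Xa := XE _ a01; have Xb := XE _ b01; have Ya := YE _ a01; have Yb := YE _ b01.
(* If the ordinate changes side, it is within e of z.2; by separation the abscissa is then at least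
   e away from z.1 and cannot change side in this step. *)
have sgnY : `|Y a - z.2| < e.
  have : (z.2 < Y a) != (z.2 < Y b) by rewrite Ya Yb !ltrDl !pmulr_rgt0.
  move/ltr_normlP : dY => [dY1 dY2].
  by case: ltP => h1; case: ltP => h2 // _; apply/ltr_normlP; split; lra.
have eX : e <= `|X a - z.1|.
  by case: (se _ a01) => // /le_lt_trans/(_ sgnY); rewrite ltxx.
move/ltr_normlP : dX => [dX1 dX2].
have Xa0 : X a - z.1 = rho a * cos (th a) by rewrite Xa addrC addKr.
have Xb0 : X b - z.1 = rho b * cos (th b) by rewrite Xb addrC addKr.
move: eX; rewrite ler_normr => /orP[eX|eX]; [left|right].
  by rewrite -(pmulr_rgt0 (cos (th a)) ra) -(pmulr_rgt0 (cos (th b)) rb) -Xa0 -Xb0; split; lra.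
by rewrite -(pmulr_rlt0 (cos (th a)) ra) -(pmulr_rlt0 (cos (th b)) rb) -Xa0 -Xb0; split; lra.
Qed.

Lemma step_eq (x u v : R) : (u < x) = (v < x) -> step x u = step x v.
Proof. by rewrite /step => ->. Qed.

Lemma step_eqr (x y u : R) : (u < x) = (u < y) -> step x u = step y u.
Proof. by rewrite /step => ->. Qed.

Hypothesis closed_gamma : gamma 0 = gamma 1.

(** The terms of the difference of the two staircases are increments of [T], which returns to its
    initial value because the curve is closed. *)
Lemma stair_locally_constant z w (e d : R) : separated_from_curve z e ->
  (forall a b, fine_step d a b -> `|X b - X a| < e / 2 /\ `|Y b - Y a| < e / 2) ->
  `|z.1 - w.1| < e / 2 -> `|z.2 - w.2| < e / 2 ->
  forall s, path (fine_step d) 0 s -> last 0 s = 1 ->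
    stair X Y 0 s z = stair X Y 0 s w.
Proof.
move=> se hd /ltr_normlP[zw1 zw1'] /ltr_normlP[zw2 zw2'] s ps ls.
pose T t := step (X t) w.1 * (step (Y t) z.2 - step (Y t) w.2).
have T01 : T 1 - T 0 = 0 by rewrite /T /X /Y closed_gamma subrr.
suff : stair X Y 0 s z - stair X Y 0 s w = 0 by move/subr0_eq.
rewrite -[RHS]T01 -[in RHS]ls -(csum_telescope T 0 s) /stair -csumB.
apply: (eq_csum ps) => a b ab.
have [/ltr_normlP[dX1 dX2] /ltr_normlP[dY1 dY2]] := hd _ _ ab.
move: ab => /and4P[a0 ab b1 _]; have a01 : 0 <= a <= 1 by lra.
have b01 : 0 <= b <= 1 by lra.
(* If the abscissa at a is far, z and w lie on the same side of it; if the ordinate is far, Y a and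
   Y b lie on the same side of z.2. [h2] is the analogue at b. *)
have h1 : (step (X a) z.1 - step (X a) w.1) * (step (Y b) z.2 - step (Y a) z.2) = 0.
  case: (se _ a01); rewrite ler_normr => /orP[h|h].
  - rewrite (@step_eq _ z.1 w.1) ?subrr ?mul0r//.
    by apply/idP/idP; lra.
  - rewrite (@step_eq _ z.1 w.1) ?subrr ?mul0r//.
    by apply/idP/idP; lra.
  - rewrite (@step_eqr (Y b) (Y a)) ?subrr ?mulr0//.
    by apply/idP/idP; lra.
  - rewrite (@step_eqr (Y b) (Y a)) ?subrr ?mulr0//.
    by apply/idP/idP; lra.
have h2 : (step (X b) w.1 - step (X a) w.1) * (step (Y b) z.2 - step (Y b) w.2) = 0.
  case: (se _ b01); rewrite ler_normr => /orP[h|h].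
  - rewrite (@step_eqr (X b) (X a)) ?subrr ?mul0r//.
    by apply/idP/idP; lra.
  - rewrite (@step_eqr (X b) (X a)) ?subrr ?mul0r//.
    by apply/idP/idP; lra.
  - rewrite (@step_eq _ z.2 w.2) ?subrr ?mulr0//.
    by apply/idP/idP; lra.
  - rewrite (@step_eq _ z.2 w.2) ?subrr ?mulr0//.
    by apply/idP/idP; lra.
rewrite /T /stair_step; lra.
Qed.

(** If |z.1| >= M, the abscissa factor is the constant [step M z.1] along the curve and the sum
    telescopes; if |z.2| >= M, every ordinate increment vanishes. *)
Lemma stair_outside M z s (d : R) :
  (forall t, 0 <= t <= 1 -> `|X t| < M /\ `|Y t| < M) ->
  M <= `|z.1| \/ M <= `|z.2| -> path (fine_step d) 0 s -> last 0 s = 1 ->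
  stair X Y 0 s z = 0.
Proof.
move=> hM hz ps ls; pose c := step M z.1; pose T t := c * step (Y t) z.2.
have T01 : T 1 - T 0 = 0 by rewrite /T /Y closed_gamma subrr.
rewrite -[RHS]T01 -[in RHS]ls -(csum_telescope T 0 s); apply: (eq_csum ps).
move=> a b /and4P[a0 ab b1 _]; have a01 : 0 <= a <= 1 by lra.
have b01 : 0 <= b <= 1 by lra.
have [/ltr_normlP[Xa Xa'] /ltr_normlP[Ya Ya']] := hM _ a01.
have [_ /ltr_normlP[Yb Yb']] := hM _ b01.
rewrite /stair_step /T -mulrBr.
case: hz; rewrite ler_normr => /orP[h|h].
- by rewrite (@step_eqr (X a) M)//; apply/idP/idP; lra.
- by rewrite (@step_eqr (X a) M)//; apply/idP/idP; lra.
- rewrite (@step_eqr (Y b) (Y a)) ?subrr ?mulr0//.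
  by apply/idP/idP; lra.
- rewrite (@step_eqr (Y b) (Y a)) ?subrr ?mulr0//.
  by apply/idP/idP; lra.
Qed.

Lemma exists_partition (d : R) : 0 < d ->
  exists2 s, path (fine_step d) 0 s & last 0 s = 1.
Proof.
move=> d0; have [n _ hn] := near_halving d0.
exists (halve n 0 1); last by rewrite last_halve.
by apply: path_halve => //; rewrite subr0; exact: (hn n (leqnn n)).
Qed.

End curves.

(** * Control by the p-variation *)

Section control.
Context {R : realType}.
Variables (gamma : R -> R * R) (p : R).
Let X t := (gamma t).1.
Let Y t := (gamma t).2.
Hypothesis p1 : 1 <= p.
Hypothesis gamma_pvar : finite_pvariation p gamma.

Let d a b : R := Defs.edist (gamma a) (gamma b) `^ p.

Let d_ge0 a b : 0 <= d a b. Proof. exact: powR_ge0. Qed.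

Let p_gt0 : 0 < p. Proof. exact: lt_le_trans ltr01 p1. Qed.

Lemma pvar_sum_csum s : pvar_sum p gamma s = csum d 0 s.
Proof. exact: (csum_nth 1 d 0 s). Qed.

Lemma partition_sum_bounded : exists C, forall s, path <%R 0 s -> last 0 s <= 1 ->
  csum d 0 s <= C.
Proof.
have := lty_poweRy (invr_neq0 (lt0r_neq0 p_gt0)) gamma_pvar.
set S := [set _ | _ in _] => Slty.
exists (fine (ereal_sup S)).
have ub s : itv_partition 0 1 s -> csum d 0 s <= fine (ereal_sup S).
  move=> ps; have Ss : S (csum d 0 s)%:E by exists s => //; rewrite pvar_sum_csum.
  have le_sup := ereal_sup_ubound Ss.
  rewrite -lee_fin fineK// fin_real// Slty andbT (lt_le_trans _ le_sup)// ltNyr//.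
move=> s ps; rewrite le_eqVlt => /orP[ls|ls]; first exact: ub.
(* A chain that stops before 1 is completed to a partition by a last, nonnegative term. *)
apply: (@le_trans _ _ (csum d 0 (rcons s 1))).
  by rewrite -cats1 csum_cat/= addr0 lerDl.
by apply: ub; split; rewrite ?last_rcons// rcons_path ps.
Qed.

(** Chains may stop short of t, so these sets increase with t and contain the empty chain for all t
    >= 0. *)
Definition pvar_upto t : set R :=
  [set csum d 0 s | s in [set s | path <%R 0 s /\ last 0 s <= t]].

Lemma pvar_upto_nonempty t : 0 <= t -> pvar_upto t !=set0.
Proof. by move=> t0; exists 0, [::]; split. Qed.

Lemma pvar_upto_has_ubound t : t <= 1 -> has_ubound (pvar_upto t).
Proof.
move=> t1; have [C hC] := partition_sum_bounded.
by exists C => _ [s [ps ls] <-]; apply: hC => //; exact: le_trans ls t1.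
Qed.

(* Appending [a, b] to a partition of [0, a] shows that the p-th power of the
   p-variation over [0, t], as a function of t, is an additive control. *)
Lemma exists_control : exists V : R -> R,
  forall a b, 0 <= a -> a <= b -> b <= 1 -> d a b <= V b - V a.
Proof.
exists (fun t => sup (pvar_upto t)) => a b a0; rewrite le_eqVlt => /orP[/eqP<- _|ab b1].
  rewrite subrr /d /Defs.edist !subrr expr0n/= addr0 sqrtr0 powR0//.
  exact: lt0r_neq0.
rewrite lerBrDl -lerBrDr; apply: ge_sup; first exact: pvar_upto_nonempty.
move=> _ [s [ps ls] <-]; rewrite lerBrDr.
have ubb := pvar_upto_has_ubound b1.
(* A chain that already ends at a is extended by b alone, since chains are strictly increasing. *)
move: ls; rewrite le_eqVlt => /orP[/eqP ls|ls].
  apply: (sup_upper_bound (conj _ ubb)).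
    by apply: pvar_upto_nonempty; lra.
  exists (rcons s b); first by split; rewrite ?last_rcons// rcons_path ps ls.
  by rewrite -cats1 csum_cat/= ls addr0.
apply: (@le_trans _ _ (csum d 0 (s ++ [:: a; b]))).
  by rewrite csum_cat/= addr0 lerD2l lerDr.
apply: (sup_upper_bound (conj _ ubb)).
  by apply: pvar_upto_nonempty; lra.
exists (s ++ [:: a; b]) => //; split; last by rewrite last_cat.
by rewrite cat_path ps/= ls ab.
Qed.

Lemma ler_edist a b : `|X b - X a| <= Defs.edist (gamma a) (gamma b) /\
  `|Y b - Y a| <= Defs.edist (gamma a) (gamma b).
Proof.
rewrite /Defs.edist -!sqrtr_sqr; split; apply: ler_wsqrtr.
  by rewrite -[leLHS]addr0 -[in leRHS]sqrrN opprB lerD2l sqr_ge0.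
by rewrite -[leLHS]add0r -[X in _ <= _ + X]sqrrN opprB lerD2r sqr_ge0.
Qed.

Hypothesis cgamma : {within `[0, 1], continuous gamma}.
Hypothesis p2 : p < 2.

(* Interpolating between the modulus of continuity and the p-variation
   replaces the power p of the increments by q in ]p, 2[. *)
Lemma exists_small_control : exists (V : R -> R) (al : R),
  [/\ 1 < al, (forall a b, 0 <= a -> a <= b -> b <= 1 -> V a <= V b) &
    forall E, 0 < E -> exists2 delta, 0 < delta &
      small_variation X V E al delta /\ small_variation Y V E al delta].
Proof.
have [V hV] := exists_control; pose q := (p + 2) / 2.
have ndV a b : 0 <= a -> a <= b -> b <= 1 -> V a <= V b.
  by move=> a0 ab b1; rewrite -subr_ge0 (le_trans (d_ge0 a b))// hV.
exists V, (q / p); split => //.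
  by rewrite ltr_pdivlMr ?p_gt0// mul1r /q; have := p2; lra.
move=> E E0.
have q2 : 0 < 2 - q by rewrite /q; have := p2; lra.
(* Chosen so that e^(2 - q) = E. For an increment D < e this gives D^2 = D^(2 - q) D^q <= E (D^p)^(q
   / p), and V controls D^p. *)
pose e := E `^ (2 - q)^-1.
have eE : e `^ (2 - q) = E.
  by rewrite /e -powRrM mulVf ?gt_eqF// powRr1// ltW.
have e0 : 0 < e by exact: powR_gt0.
have [delta delta0 hd] := curve_unif_continuous cgamma e0.
exists delta => //.
have main (Z : R -> R) a b : 0 <= a -> a <= b -> b <= 1 ->
    `|Z b - Z a| < e -> `|Z b - Z a| <= Defs.edist (gamma a) (gamma b) ->
    (Z b - Z a) ^+ 2 <= E * (V b - V a) `^ (q / p).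
  move=> a0 ab b1 De Dd; set D := `|Z b - Z a| in De Dd.
  have -> : (Z b - Z a) ^+ 2 = D ^+ 2 by rewrite /D -normrX ger0_norm ?sqr_ge0.
  have D0 : 0 <= D by exact: normr_ge0.
  have -> : D ^+ 2 = D `^ (2 - q) * D `^ q.
    rewrite -powRD; last by rewrite subrK; apply/implyP; rewrite pnatr_eq0.
    by rewrite subrK powR_mulrn.
  apply: ler_pM; rewrite ?powR_ge0//.
    by rewrite -eE ge0_ler_powR// ?nnegrE// ltW.
  have qE : q = p * (q / p) by rewrite mulrCA divff ?mulr1// lt0r_neq0 ?p_gt0.
  rewrite [X in D `^ X]qE powRrM.
  have dV := hV a b a0 ab b1.
  apply: ge0_ler_powR; rewrite ?nnegrE ?powR_ge0//.
  - by rewrite divr_ge0 ?(ltW p_gt0)// /q; have := p1; lra.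
  - exact: le_trans (d_ge0 a b) dV.
  - apply: le_trans dV; apply: ge0_ler_powR; rewrite ?nnegrE ?(ltW p_gt0)//.
    exact: sqrtr_ge0.
have cl a b : 0 <= a -> a <= b -> b <= 1 -> b - a < delta ->
    `|X b - X a| < e /\ `|Y b - Y a| < e.
  by move=> a0 ab b1 bad; apply: hd; rewrite ?ger0_norm ?subr_ge0//; lra.
have ed := ler_edist.
split=> a b a0 ab b1 bad; have [cX cY] := cl _ _ a0 ab b1 bad;
  have [eX eY] := ed a b; exact: main.
Qed.

End control.

(** * Limits of the staircase functions *)

Section null_image.
Context {R : realType}.
Notation mu2 := (@lebesgue_measure R \x @lebesgue_measure R)%E.

Definition plane_box (c : R * R) (r : R) : set (R * R) :=
  `[c.1 - r, c.1 + r]%classic `*` `[c.2 - r, c.2 + r]%classic.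

Lemma measurable_plane_box c r : measurable (plane_box c r).
Proof. by apply: measurableX; exact: measurable_itv. Qed.

Lemma plane_boxP c r z :
  plane_box c r z <-> `|z.1 - c.1| <= r /\ `|z.2 - c.2| <= r.
Proof.
by rewrite /plane_box/= !in_itv/= -!ler_distl.
Qed.

Lemma measure_plane_box c r : 0 <= r -> mu2 (plane_box c r) = (4 * r ^+ 2)%:E.
Proof.
move=> r0; apply: (etrans (product_measure1E _ _ _ _)); try exact: measurable_itv.
have itvE (x : R) : lebesgue_measure `[x - r, x + r]%classic = (2 * r)%:E.
  rewrite lebesgue_measure_itv/= lte_fin.
  have [r_gt0|r_le0] := ltP (x - r) (x + r); first by rewrite -EFinD; congr (_%:E); ring.
  by congr (_%:E); lra.
rewrite (_ : 4 * r ^+ 2 = (2 * r) * (2 * r)); last by ring.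
by rewrite EFinM; congr (_ * _)%E; exact: itvE.
Qed.

Variables (gamma : R -> R * R) (V : R -> R) (E al delta : R).
Let X t := (gamma t).1.
Let Y t := (gamma t).2.
Hypothesis ndV : forall a b, 0 <= a -> a <= b -> b <= 1 -> V a <= V b.
Hypothesis E0 : 0 <= E.
Hypothesis al1 : 1 <= al.
Hypothesis hX : small_variation X V E al delta.
Hypothesis hY : small_variation Y V E al delta.

(** The arc over a step [a, b] lies in the square centred at gamma a with half-side the square root
    of E (V b - V a)^al; the areas add up by superadditivity. *)
Lemma arc_cover a s : 0 <= a -> a <= 1 -> path (fine_step delta) a s ->
  exists B, [/\ measurable B,
    (mu2 B <= (4 * (E * (V (last a s) - V a) `^ al))%:E)%E &
    forall t, a <= t <= last a s -> B (gamma t)].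
Proof.
elim: s a => [|b s IH] a a0 a1 ps.
  exists (plane_box (gamma a) 0); split; first exact: measurable_plane_box.
    rewrite measure_plane_box// expr0n/= mulr0 lee_fin.
    by rewrite mulr_ge0// mulr_ge0// powR_ge0.
  move=> t /= /le_anti ->; apply/plane_boxP.
  by rewrite !subrr normr0.
move: ps => /= /andP[/and4P[_ ab b1 bd] ps].
have b0 : 0 <= b by lra.
have [B [mB muB hB]] := IH b b0 b1 ps.
pose r := Num.sqrt (E * (V b - V a) `^ al).
have r0 : 0 <= r by exact: sqrtr_ge0.
have rE : r ^+ 2 = E * (V b - V a) `^ al.
  by rewrite sqr_sqrtr// mulr_ge0// powR_ge0.
have near_a t : a <= t -> t <= b -> `|X t - X a| <= r /\ `|Y t - Y a| <= r.
  move=> at_ tb.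
  have VV : E * (V t - V a) `^ al <= E * (V b - V a) `^ al.
    have Vat : V a <= V t by apply: ndV; lra.
    have Vtb : V t <= V b by apply: ndV; lra.
    apply: ler_wpM2l => //; apply: ge0_ler_powR; rewrite ?nnegrE;
      by [exact: le_trans ler01 al1|lra].
  rewrite -!sqrtr_sqr; split; apply: ler_wsqrtr; apply: le_trans VV.
    by apply: hX; lra.
  by apply: hY; lra.
exists (plane_box (gamma a) r `|` B); split.
- by apply: measurableU => //; exact: measurable_plane_box.
- have mbox := measurable_plane_box (gamma a) r.
  have subadd : (mu2 (plane_box (gamma a) r `|` B) <=
      mu2 (plane_box (gamma a) r) + mu2 B)%E by exact: measureU2.
  apply: (le_trans subadd).
  apply: (@le_trans _ _ ((4 * r ^+ 2)%:E + (4 * (E * (V (last b s) - V b) `^ al))%:E)%E).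
    by apply: leeD => //; rewrite measure_plane_box.
  rewrite -EFinD lee_fin rE -!mulrDr ler_wpM2l// ler_wpM2l//.
  have bl := path_last_ge ps; have l1 := path_last_le1 b1 ps.
  apply: le_trans (powR_superadditive _ _ _) _ => //.
  + by rewrite subr_ge0 ndV//; lra.
  + by rewrite subr_ge0 ndV//; lra.
  + by rewrite addrC addrA subrK.
- move=> t /andP[at_ tl]; have [tb|bt] := leP t b; last first.
    by right; apply: hB; rewrite tl ltW.
  by left; apply/plane_boxP; exact: near_a.
Qed.

End null_image.

(** * Staircases converge to the indicator of the interior *)

Section interior.
Context {R : realType}.
Notation mu2 := (@lebesgue_measure R \x @lebesgue_measure R)%E.
Variable gamma : R -> R * R.
Let X t := (gamma t).1.
Let Y t := (gamma t).2.
Hypothesis cgamma : {within `[0, 1], continuous gamma}.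
Hypothesis closed_gamma : gamma 0 = gamma 1.
Hypothesis gamma_pos : positively_oriented gamma.

Let D : set (R * R) := ~` curve_image gamma.

Lemma open_off_curve : open D.
Proof. exact/closed_openC/closed_curve_image. Qed.

(** Staircases take integer values, so convergence at z as the mesh tends to 0 amounts to being
    eventually equal to k. *)
Definition stair_limit (z : R * R) (k : R) : Prop := exists2 d, 0 < d &
  forall s, path (fine_step d) 0 s -> last 0 s = 1 -> stair X Y 0 s z = k.

Lemma stair_limit_locally_constant z : D z ->
  exists2 e, 0 < e & forall w k, ball z e w -> stair_limit z k <-> stair_limit w k.
Proof.
move=> Dz; have [e e0 se] := off_curve_separated cgamma Dz.
have e2 : 0 < e / 2 by rewrite divr_gt0.
have [d d0 hd] := curve_unif_continuous cgamma e2.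
exists (e / 2) => // w k [zw1 zw2].
have eq_stair s : path (fine_step d) 0 s -> last 0 s = 1 ->
    stair X Y 0 s z = stair X Y 0 s w.
  exact: (stair_locally_constant closed_gamma se (fine_step_close hd)).
have sub d' s : path (fine_step (Num.min d d')) 0 s ->
    path (fine_step d) 0 s /\ path (fine_step d') 0 s.
  by move=> ps; split; apply: sub_path ps; apply: fine_stepW; rewrite ge_min lexx ?orbT.
split=> -[d' d'0 h]; exists (Num.min d d'); rewrite ?lt_min ?d0// => s /sub[p1 p2] ls.
  by rewrite -eq_stair// h.
by rewrite eq_stair// h.
Qed.

Lemma stair_limit_unique z k l : stair_limit z k -> stair_limit z l -> k = l.
Proof.
move=> [d d0 hk] [d' d'0 hl].
have dd : 0 < Num.min d d' by rewrite lt_min d0.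
have [s ps ls] := exists_partition dd.
rewrite -(hk s _ ls) ?(hl s _ ls)//; apply: sub_path ps; apply: fine_stepW;
  by rewrite ge_min lexx ?orbT.
Qed.

Lemma stair_limit_interior z : jordan_int gamma z -> stair_limit z 1.
Proof.
move=> jz; have := gamma_pos jz; have [nz _] := jz.
by move=> /(stair_winding cgamma nz).
Qed.

(** The component of z is unbounded, so it has a point beyond a box around the curve, where
    staircases vanish. The points of limit 0 are open and closed in the component, hence fill it. *)
Lemma stair_limit_exterior z : D z -> ~ jordan_int gamma z -> stair_limit z 0.
Proof.
move=> Dz njz; set C := connected_component D z.
have CD : C `<=` D by exact: connected_component_sub.
have nbC : ~ bounded_set C by move=> bC; apply: njz; split.
have [M M0 hM] := curve_bounded cgamma.
have [w Cw Mw] : exists2 w, C w & M <= `|w|.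
  apply: contrapT => h; apply: nbC; exists M; split; first exact: num_real.
  move=> N MN w Cw; apply: ltW; apply: lt_trans MN; rewrite ltNge; apply/negP => Mw.
  by apply: h; exists w.
pose A := [set w | stair_limit w 0].
have Aw : A w.
  exists 1 => // s ps ls; apply: (stair_outside closed_gamma hM _ ps ls).
  by move: Mw; rewrite prod_normE le_max => /orP[]; [left|right].
suff : C `&` A = C.
  by move=> CA; have : C z by [exact: connected_component_refl]; rewrite -CA => -[].
apply: (component_connected (A := D) (x := z)); first by exists w.
- exists A°; first exact: open_interior.
  apply/seteqP; split => [u [Cu Au]|u [Cu /interior_subset Au]]; split => //.
  have [e e0 he] := stair_limit_locally_constant (CD _ Cu).
  by apply/nbhs_ballP; exists e => //= v uv; apply/(he v 0 uv).
- exists (closure A); first exact: closed_closure.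
  apply/seteqP; split => [u [Cu Au]|u [Cu Au]]; split => //.
    exact: subset_closure.
  have [e e0 he] := stair_limit_locally_constant (CD _ Cu).
  have [v [Av uv]] := Au _ (nbhsx_ballx u e e0).
  by apply/(he v 0 uv).
Qed.

Lemma stair_limit_indic z : D z -> stair_limit z (\1_(jordan_int gamma) z).
Proof.
move=> Dz; rewrite indicE; have [jz|jz] := pselect (jordan_int gamma z).
  by rewrite mem_set//; exact: stair_limit_interior.
by rewrite memNset//; exact: stair_limit_exterior.
Qed.

(** The limit value is locally constant and separates interior from exterior. Openness yields
    measurability. *)
Lemma open_jordan_int : open (jordan_int gamma).
Proof.
rewrite openE => z jz; have [Dz _] := jz.
have [e e0 he] := stair_limit_locally_constant Dz.
have /nbhs_ballP[e' /= e'0 he'] : nbhs z D.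
  by apply: open_nbhs_nbhs; split => //; exact: open_off_curve.
apply/nbhs_ballP; exists (Num.min e e'); first by rewrite /= lt_min e0.
move=> w zw.
have zw1 : ball z e w by apply: le_ball zw; rewrite ge_min lexx.
have Dw : D w by apply: he'; apply: le_ball zw; rewrite ge_min lexx orbT.
apply: contrapT => njw; have := stair_limit_exterior Dw njw.
move=> /(he w 0 zw1) l0; have := stair_limit_unique l0 (stair_limit_interior jz).
by move=> /esym/eqP; rewrite oner_eq0.
Qed.

Lemma jordan_int_bounded M : (forall t, 0 <= t <= 1 -> `|X t| < M /\ `|Y t| < M) ->
  forall z, jordan_int gamma z -> `|z.1| < M /\ `|z.2| < M.
Proof.
move=> hM z jz.
have h : ~ (M <= `|z.1| \/ M <= `|z.2|).
  move=> Mz; have l0 : stair_limit z 0.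
    by exists 1 => // s ps ls; exact: (stair_outside closed_gamma hM _ ps ls).
  have := stair_limit_unique l0 (stair_limit_interior jz).
  by move=> /esym/eqP; rewrite oner_eq0.
by split; rewrite ltNge; apply/negP => ?; apply: h; [left|right].
Qed.

Variables (p : R).
Hypothesis p1 : 1 <= p.
Hypothesis p2 : p < 2.
Hypothesis gamma_pvar : finite_pvariation p gamma.

Lemma curve_image_null : mu2 (curve_image gamma) = 0%E.
Proof.
have [V [al [al1 ndV hE]]] := exists_small_control p1 gamma_pvar cgamma p2.
have mI : measurable (curve_image gamma).
  rewrite -[curve_image _]setCK; apply: measurableC.
  exact: open_measurable_plane open_off_curve.
apply/eqP; rewrite eq_le measure_ge0 andbT; apply/lee_addgt0Pr => e e0.
pose W := (V 1 - V 0) `^ al; have W0 : 0 <= W by exact: powR_ge0.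
(* The covering has area at most 4 E W, which is below e for this E; the 1 keeps the denominator
   positive. *)
have E0 : 0 < e / (4 * (W + 1)) by rewrite divr_gt0// mulr_gt0//; lra.
have [delta delta0 [hX hY]] := hE _ E0.
have [s ps ls] := exists_partition delta0.
have [B [mB muB hB]] := arc_cover ndV (ltW E0) (ltW al1) hX hY (lexx 0) ler01 ps.
rewrite add0e; apply: (@le_trans _ _ (mu2 B)).
  apply: le_measure; rewrite ?inE// => _ [t /= t01 <-].
  by apply: hB; rewrite ls; rewrite in_itv/= in t01.
rewrite (le_trans muB)// lee_fin ls -/W.
rewrite mulrA (_ : 4 * (e / (4 * (W + 1))) = e / (W + 1)); last first.
  by field; rewrite gt_eqF//; lra.
rewrite mulrAC ler_pdivrMr; first by rewrite ler_pM2l//; lra.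
lra.
Qed.

Definition increments_product a b : R := `|X b - X a| * `|Y b - Y a|.

(** The integral is bounded by Fatou's lemma along dyadic refinements of s, with [stair_refine_le]
    uniform in n. The sums of squares bound the error in [stair_green]; the sum of products bounds
    the corners left by summation by parts. *)
Lemma stair_L1_close (eps : R) : 0 < eps -> exists2 delta, 0 < delta &
  forall s, path (fine_step delta) 0 s -> last 0 s = 1 ->
  [/\ (\int[mu2]_(z in D) `|stair X Y 0 s z - \1_(jordan_int gamma) z|%:E <=
         eps%:E)%E,
      csum (fun a b => (X b - X a) ^+ 2) 0 s <= eps,
      csum (fun a b => (Y b - Y a) ^+ 2) 0 s <= eps &
      csum increments_product 0 s <= eps].
Proof.
move=> eps0.
have [V [al [al1 ndV hE]]] := exists_small_control p1 gamma_pvar cgamma p2.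
have [K K0 hK] := sewing_constant al1.
pose W := (V 1 - V 0) `^ al; have W0 : 0 <= W by exact: powR_ge0.
(* Makes both K E W and E W at most eps. *)
pose E := eps / ((K + 1) * (W + 1)).
have KW : 0 < (K + 1) * (W + 1) by rewrite mulr_gt0//; lra.
have E0 : 0 < E by rewrite divr_gt0.
have EKW : (K + 1) * (E * W) <= eps.
  have -> : eps = (K + 1) * (E * (W + 1)) by rewrite /E mulrCA mulrVK// unitfE gt_eqF.
  by rewrite ler_wpM2l// ?ler_wpM2l//; lra.
have EW0 : 0 <= E * W by rewrite mulr_ge0// ltW.
have KEW : K * (E * W) <= eps by lra.
have EW : E * W <= eps by have := mulr_ge0 K0 EW0; lra.
have [delta delta0 [hX hY]] := hE _ E0.
exists delta => // s ps ls.
have csumE (c : R -> R -> R) : (forall a b, fine_step delta a b ->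
    c a b <= E * (V b - V a) `^ al) -> csum c 0 s <= eps.
  move=> hc; apply: le_trans EW; apply: le_trans (ler_csum ps hc) _.
  rewrite csumZ ler_pM2l//.
  have := csum_powR_le ndV (ltW al1) (lexx 0) ler01 ps.
  by rewrite ls.
have mJ : measurable (jordan_int gamma).
  exact: open_measurable_plane open_jordan_int.
have mD : measurable D by exact: open_measurable_plane open_off_curve.
split; last first.
- apply: csumE => a b /and4P[a0 ab b1 bad].
  by apply: (@small_variationM _ X Y V E al delta ndV (ltW E0) (ltW al1) hX hY a a b a b b); lra.
- by apply: csumE => a b /and4P[a0 ab b1 bad]; apply: hY => //; exact: ltW.
- by apply: csumE => a b /and4P[a0 ab b1 bad]; apply: hX => //; exact: ltW.
pose g n z : R := `|stair X Y 0 (refine_partition n 0 s) z - stair X Y 0 s z|.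
have mg n : measurable_fun setT (g n).
  by apply: measurableT_comp => //; apply: measurable_funB; exact: measurable_stair.
have -> : (\int[mu2]_(z in D) `|stair X Y 0 s z - \1_(jordan_int gamma) z|%:E =
    \int[mu2]_(z in D) limn_einf (fun n => (g n z)%:E))%E.
  apply: eq_integral => z; rewrite inE => Dz.
  have [d d0 hd] := stair_limit_indic Dz.
  (* Here d depends on z but not on n, so the refined staircase at z eventually equals its limit and
     [g n z] is eventually constant. *)
  have gE : \forall n \near \oo,
      (`|stair X Y 0 s z - \1_(jordan_int gamma) z|%:E = (g n z)%:E)%E.
    near=> n; rewrite /g distrC -(hd (refine_partition n 0 s)) ?last_refine//.
    by apply: (path_refine ps); near: n; exact: near_halving.
  have /cvg_limn_einf_sup[-> _] // : (g n z)%:E @[n --> \oo] -->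
      `|stair X Y 0 s z - \1_(jordan_int gamma) z|%:E.
  apply: cvg_near_cst; apply: filterS gE => n; exact: esym.
apply: (@le_trans _ _ (limn_einf (fun n => \int[mu2]_(z in D) (g n z)%:E))%E).
  apply: fatou => //.
    by move=> n; apply: (measurable_funS measurableT) => //; apply/measurable_EFinP; exact: mg.
  by move=> n z _; rewrite lee_fin normr_ge0.
rewrite limn_einf_lim; apply: lime_le.
  by apply: is_cvg_einfs.
apply: nearW => n.
apply: (@le_trans _ _ (\int[mu2]_(z in D) (g n z)%:E)%E).
  by apply: ereal_inf_lbound; exists n => /=.
apply: (@le_trans _ _ (\int[mu2]_z (g n z)%:E)%E).
  apply: ge0_subset_integral; [exact: mD|exact: measurableT| | |by []];
    last by move=> z _; rewrite lee_fin normr_ge0.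
  by apply/measurable_EFinP; exact: mg.
have := stair_refine_le ndV (ltW E0) (ltW al1) hX hY K0 hK n (lexx 0) ler01 ps.
rewrite ls -/W => /le_trans; apply.
by rewrite lee_fin.
Unshelve. all: by end_near. Qed.

End interior.

(** * Green's formula for staircases *)

Section plane_calculus.
Context {R : realType}.
Notation mu := (@lebesgue_measure R).
Notation mu2 := (@lebesgue_measure R \x @lebesgue_measure R)%E.

Lemma is_derive_partial_x (f : R * R -> R) u v : derivable f (u, v) (1, 0) ->
  is_derive u 1 (fun u => f (u, v)) (partial_x f (u, v)).
Proof.
move=> df.
have E : (fun h : R => h^-1 *: (((fun u => f (u, v)) \o shift u) (h *: 1) - f (u, v)))
    = (fun h => h^-1 *: ((f \o shift (u, v)) (h *: (1, 0) : R * R) - f (u, v))).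
  apply/funext => h /=; congr (_ *: (f _ - _)).
  by rewrite -[RHS]/(h *: 1 + u, h *: 0 + v) scaler0 add0r.
by split; rewrite ?/derivable ?/partial_x ?/derive E.
Qed.

Lemma is_derive_partial_y (f : R * R -> R) u v : derivable f (u, v) (0, 1) ->
  is_derive v 1 (fun v => f (u, v)) (partial_y f (u, v)).
Proof.
move=> df.
have E : (fun h : R => h^-1 *: (((fun v => f (u, v)) \o shift v) (h *: 1) - f (u, v)))
    = (fun h => h^-1 *: ((f \o shift (u, v)) (h *: (0, 1) : R * R) - f (u, v))).
  apply/funext => h /=; congr (_ *: (f _ - _)).
  by rewrite -[RHS]/(h *: 0 + u, h *: 1 + v) scaler0 add0r.
by split; rewrite ?/derivable ?/partial_y ?/derive E.
Qed.

Lemma derivable_continuous1 (f : R -> R) u : derivable f u 1 ->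
  {for u, continuous f}.
Proof. by move/derivable1_diffP/differentiable_continuous. Qed.

Definition centered_box (M : R) : set (R * R) :=
  `[- M, M]%classic `*` `[- M, M]%classic.

Lemma measurable_centered_box M : measurable (centered_box M).
Proof. by apply: measurableX; exact: measurable_itv. Qed.

Lemma compact_centered_box M : compact (centered_box M).
Proof. by apply: compact_setX; exact: segment_compact. Qed.

Lemma measure_centered_box_lty M : (mu2 (centered_box M) < +oo)%E.
Proof.
pose I := `[- M, M]%classic : set R.
rewrite (_ : mu2 _ = mu I * mu I)%E; last first.
  by apply: product_measure1E; exact: measurable_itv.
rewrite /I lebesgue_measure_itv/=; case: ifPn => _; first by rewrite -!EFinD -EFinM ltry.
by rewrite mul0e.
Qed.

Lemma continuous_bounded_on_box (h : R * R -> R) M : continuous h ->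
  exists2 H, 0 <= H & forall z, centered_box M z -> `|h z| <= H.
Proof.
move=> ch; have cI : compact (h @` centered_box M).
  apply: continuous_compact; last exact: compact_centered_box.
  exact: continuous_subspaceT.
have [B [_ hB]] := compact_bounded cI.
exists (`|B| + 1); first by rewrite addr_ge0.
move=> z Mz; apply: (hB (`|B| + 1)); last by exists z.
by rewrite (le_lt_trans (ler_norm _))// ltrDl.
Qed.

Lemma integrable_on_box (h : R * R -> R) M H : measurable_fun setT h ->
  (forall z, centered_box M z -> `|h z| <= H) ->
  mu2.-integrable (centered_box M) (EFin \o h).
Proof.
move=> mh hH; apply: measurable_bounded_integrable.
- exact: measurable_centered_box.
- exact: measure_centered_box_lty.
- exact: (measurable_funS measurableT).
- exists H; split; first exact: num_real.
  by move=> B HB z Mz; rewrite /= (le_trans (hH z Mz))// ltW.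
Qed.

(** The endpoints come in either order because a step of the curve may go down as well as up. *)
Lemma MVT_sym (F dF : R -> R) (a b : R) :
  (forall x, Num.min a b <= x <= Num.max a b -> is_derive x 1 F (dF x)) ->
  exists c, [/\ Num.min a b <= c <= Num.max a b, `|c - a| <= `|b - a| &
    F b - F a = dF c * (b - a)].
Proof.
wlog ab : a b / a <= b => [hw|] hF.
  have /orP[ab|ba] := le_total a b; first exact: hw _ _ ab hF.
  have [|c [cab ca Fc]] := hw b a ba.
    by move=> x; rewrite minC maxC; exact: hF.
  exists c; rewrite minC maxC; split=> //; last by rewrite -opprB Fc; ring.
  move: cab; rewrite (min_idPl ba) (max_idPr ba) => /andP[bc ca'].
  by rewrite !ler0_norm; lra.
move: hF; rewrite (min_idPl ab) (max_idPr ab) => hF.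
have [||c cab Fc] := @MVT_segment R F dF a b ab.
- by move=> x /subset_itv_oo_cc; rewrite in_itv/=; exact: hF.
- by apply: derivable_within_continuous => x; rewrite in_itv/= => /hF[].
exists c; move: cab; rewrite in_itv/= => /andP[ac cb]; split=> //.
  by rewrite ac.
by rewrite !ger0_norm; lra.
Qed.

Section green_rectangle.
Variables (f : R * R -> R) (M : R).
Hypothesis hf : continuous_partials f.

Let fx := partial_x f.

Let dfx (u v : R) : is_derive u 1 (fun u => f (u, v)) (fx (u, v)).
Proof. by apply: is_derive_partial_x; case: hf. Qed.

Let dfy (u v : R) : is_derive v 1 (fun v => f (u, v)) (partial_y f (u, v)).
Proof. by apply: is_derive_partial_y; case: hf. Qed.

Lemma continuous_slice_y u : continuous (fun v => f (u, v)).
Proof. by move=> v; apply: derivable_continuous1; case: (dfy u v). Qed.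

Lemma continuous_slice_partial_x v : continuous (fun u => fx (u, v)).
Proof.
move=> u; have [_ _ cfx _] := hf.
apply: (@continuous_comp _ _ _ (fun u => (u, v)) fx); last exact: cfx.
exact: (@cvg_pair _ _ _ (nbhs u) (nbhs u) (nbhs v) _ _ _ id (fun=> v) cvg_id (cvg_cst _)).
Qed.

Lemma integral_partial_x a b v : a <= b ->
  (\int[mu]_(u in `[a, b]) (fx (u, v))%:E = (f (b, v) - f (a, v))%:E)%E.
Proof.
rewrite le_eqVlt => /orP[/eqP <-|ab].
  by rewrite set_itv1 integral_set1 subrr.
rewrite (@continuous_FTC2 _ (fun u => fx (u, v)) (fun u => f (u, v)))//.
- by apply: continuous_subspaceT; exact: continuous_slice_partial_x.
- split.
  + by move=> u _; case: (dfx u v).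
  + by apply: cvg_at_right_filter; apply: derivable_continuous1; case: (dfx a v).
  + by apply: cvg_at_left_filter; apply: derivable_continuous1; case: (dfx b v).
- by move=> u _; rewrite derive1E; case: (dfx u v).
Qed.

Definition slice_integral x y : R := (\int[mu]_(v in `[- M, y]) f (x, v))%R.

Lemma integrable_slice x y : mu.-integrable `[- M, y] (EFin \o (fun v => f (x, v))).
Proof.
apply: continuous_compact_integrable; first exact: segment_compact.
by apply: continuous_subspaceT; exact: continuous_slice_y.
Qed.

Lemma is_derive_slice_integral x y : - M < y ->
  is_derive y 1 (slice_integral x) (f (x, y)).
Proof.
move=> My; have y1 : y < y + 1 by rewrite ltrDl.
have [d e] := continuous_FTC1_closed y1 (integrable_slice x (y + 1)) My
  (@continuous_slice_y x y).
by split; [exact: d|rewrite -derive1E; exact: e].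
Qed.

(** The integral of f_x over the part of the box to the lower left of (x, y). A stair term is a
    difference of two such quadrant indicators. *)
Definition primitive x y : R :=
  (\int[mu2]_(z in centered_box M) (fx z * (step x z.1 * step y z.2)))%R.

Lemma step_ge0 (x u : R) : 0 <= step x u. Proof. by rewrite /step ler0n. Qed.

Lemma step_le1 (x u : R) : step x u <= 1.
Proof. by rewrite /step; case: (u < x). Qed.

Lemma measurable_quadrant x y : measurable_fun setT
  (fun z : R * R => fx z * (step x z.1 * step y z.2)).
Proof.
have [_ _ cfx _] := hf; apply: measurable_funM.
  exact: continuous_measurable_plane.
by apply: measurable_funM; [exact: measurable_step1|exact: measurable_step2].
Qed.

Lemma integrable_quadrant x y : mu2.-integrable (centered_box M)
  (EFin \o (fun z : R * R => fx z * (step x z.1 * step y z.2))).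
Proof.
have [_ _ cfx _] := hf; have [H H0 hH] := continuous_bounded_on_box M cfx.
apply: (@integrable_on_box _ M H); first exact: measurable_quadrant.
move=> z Mz; rewrite normrM -[leRHS]mulr1 ler_pM// ?hH//.
have := (step_ge0 x z.1, step_ge0 y z.2, step_le1 x z.1, step_le1 y z.2).
by rewrite ger0_norm ?mulr_ge0 ?step_ge0// mulr_ile1 ?step_ge0 ?step_le1.
Qed.

(** Fubini's theorem with u as inner variable, and the fundamental theorem of calculus on
    [-M, x]. *)
Lemma primitiveE x y : `|x| < M -> `|y| < M ->
  primitive x y = slice_integral x y - slice_integral (- M) y.
Proof.
move=> /ltr_normlP[x1 x2] /ltr_normlP[y1 y2].
pose k (z : R * R) := ((fun z => fx z * (step x z.1 * step y z.2)) \_ (centered_box M)) z.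
have ik : mu2.-integrable setT (EFin \o k).
  rewrite /k -restrict_EFin; apply/(integrable_restrict _ _ _) => //.
    exact: measurable_centered_box.
  by rewrite setTI; exact: integrable_quadrant.
rewrite /primitive Rintegral_mkcond /Rintegral -(integral21_prod_meas1 ik) /fubini_G.
(* The strict inequalities in [step] give right-open intervals, the calculus lemmas closed ones;
   endpoints are null. *)
have ico (h : R -> R) : mu.-integrable `[- M, y] (EFin \o h) ->
    mu.-integrable `[- M, y[ (EFin \o h).
  apply: integrableS; [exact: measurable_itv|exact: measurable_itv|].
  by move=> v /=; rewrite !in_itv/= => /andP[-> /ltW].
rewrite /slice_integral -RintegralB//; [|exact: integrable_slice..].
rewrite -Rintegral_itv_bndo_bndc; last first.
  apply: ico.
  apply: (integrableB _ (integrable_slice x y) (integrable_slice (- M) y)).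
  exact: measurable_itv.
rewrite /Rintegral [in RHS]integral_mkcond; congr fine; apply: eq_integral => v _ /=.
rewrite patchE; have [vin|vout] := boolP (v \in `[- M, y[%classic); last first.
  rewrite integral0_eq// => u _; congr (_%:E); rewrite /k patchE; case: ifPn => //.
  rewrite in_setX /= => /andP[_]; move: vout; rewrite !mem_setE !in_itv/=.
  move=> h /andP[h1 h2]; rewrite h1/= in h.
  by rewrite /step (negbTE h) !mulr0.
move: vin; rewrite mem_setE in_itv/= => /andP[v1 v2].
have Mx : - M <= x by lra.
rewrite -integral_partial_x// -integral_itv_bndo_bndc; last first.
  apply/measurable_EFinP; apply: measurable_funTS.
  by apply: continuous_measurable_fun; exact: continuous_slice_partial_x.
rewrite [in RHS]integral_mkcond; apply: eq_integral => u _ /=.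
rewrite /k !patchE in_setX /= !mem_setE !in_itv/= v1 (_ : v <= M) ?andbT; last lra.
rewrite /step v2 mulr1.
have [Mu|uM] := leP (- M) u => //=; have [ux|xu] := ltP u x => //=.
  by rewrite (_ : u <= M) ?mulr1//; lra.
by rewrite mulr0; case: ifP.
Qed.

Lemma primitive_stair (X Y : R -> R) a s :
  let F := fun z => fx z * stair X Y a s z in
  mu2.-integrable (centered_box M) (EFin \o F) /\
  (\int[mu2]_(z in centered_box M) F z)%R =
    csum (fun a b => primitive (X a) (Y b) - primitive (X a) (Y a)) a s.
Proof.
have mbox := measurable_centered_box M.
elim: s a => [|b s IH] a /=.
  rewrite (_ : (fun _ => _) = fun=> 0).
    split; first by apply: integrable0.
    by rewrite Rintegral_cst// mul0r.
  by apply/funext => z; rewrite /stair mulr0.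
have [iF EF] := IH b.
pose q x y (z : R * R) := fx z * (step x z.1 * step y z.2).
have -> : (fun z => fx z * stair X Y a (b :: s) z) =
    (fun z => (q (X a) (Y b) z - q (X a) (Y a) z) + fx z * stair X Y b s z).
  by apply/funext => z; rewrite /q /stair/= /stair_step; ring.
have i1 := integrable_quadrant (X a) (Y b).
have i2 := integrable_quadrant (X a) (Y a).
have i12 : mu2.-integrable (centered_box M)
    (EFin \o (fun z => q (X a) (Y b) z - q (X a) (Y a) z)).
  by apply: (integrableB _ i1 i2); exact: mbox.
split; first by apply: (integrableD _ i12 iF); exact: mbox.
by rewrite RintegralD// RintegralB// EF.
Qed.

(** The slices at -M telescope to 0 around the closed curve. What remains on a step is f(x_a, y_a)
    dy minus the integral of f(x_a, .) from y_a to y_b, at most L dy^2 where L bounds f_y on the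
    box. *)
Lemma stair_green : exists2 L, 0 <= L & forall (X Y : R -> R) d s,
  (forall t, 0 <= t <= 1 -> `|X t| < M /\ `|Y t| < M) -> Y 0 = Y 1 ->
  path (fine_step d) 0 s -> last 0 s = 1 ->
  `|csum (fun a b => f (X a, Y a) * (Y b - Y a)) 0 s -
    (\int[mu2]_(z in centered_box M) (fx z * stair X Y 0 s z))%R| <=
  L * csum (fun a b => (Y b - Y a) ^+ 2) 0 s.
Proof.
have [_ _ _ cfy] := hf.
have [L L0 hL] := continuous_bounded_on_box M cfy; exists L => // X Y d s hM Y01 ps ls.
have [_ ->] := primitive_stair X Y 0 s.
pose G t := slice_integral (- M) (Y t).
have G0 : csum (fun a b => G b - G a) 0 s = 0.
  by rewrite csum_telescope ls /G Y01 subrr.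
rewrite -[X in _ - X]addr0 -[X in _ - (_ + X)]G0 -csumD -csumB -csumZ.
apply: le_trans (ler_norm_csum _ _ _) _; apply: (ler_csum ps) => a b.
move=> /and4P[a0 ab b1 _]; have a01 : 0 <= a <= 1 by lra.
have b01 : 0 <= b <= 1 by lra.
have [Xa Ya] := hM _ a01; have [_ Yb] := hM _ b01.
rewrite !primitiveE// /G.
have -> : f (X a, Y a) * (Y b - Y a) -
    (slice_integral (X a) (Y b) - slice_integral (- M) (Y b) -
     (slice_integral (X a) (Y a) - slice_integral (- M) (Y a)) +
     (slice_integral (- M) (Y b) - slice_integral (- M) (Y a))) =
    f (X a, Y a) * (Y b - Y a) -
    (slice_integral (X a) (Y b) - slice_integral (X a) (Y a)) by ring.
have inM y : Num.min (Y a) (Y b) <= y <= Num.max (Y a) (Y b) -> - M < y < M.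
  move: Ya Yb => /ltr_normlP[? ?] /ltr_normlP[? ?].
  by rewrite ge_min le_max => /andP[/orP[?|?] /orP[?|?]]; apply/andP; split; lra.
(* The first mean value replaces the slice integral by f(x_a, c) dy; the second bounds f(x_a, c) -
   f(x_a, y_a) through f_y. *)
have [|c [cab ca ->]] := @MVT_sym (slice_integral (X a)) (fun y => f (X a, y)) (Y a) (Y b).
  by move=> y /inM/andP[My _]; exact: is_derive_slice_integral.
have [|e [eab ea fE]] := @MVT_sym (fun y => f (X a, y)) (fun y => partial_y f (X a, y)) (Y a) c.
  by move=> y _; exact: dfy.
have Mc := inM _ cab.
have Me : - M < e < M.
  move: eab Mc Ya => + /andP[? ?] /ltr_normlP[? ?].
  by rewrite ge_min le_max => /andP[/orP[?|?] /orP[?|?]]; apply/andP; split; lra.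
rewrite -mulrBl -opprB fE mulNr normrN !normrM.
have hLe : `|partial_y f (X a, e)| <= L.
  apply: hL; move: Xa Me => /ltr_normlP[? ?] /andP[? ?].
  by split; rewrite /= in_itv/=; apply/andP; split; lra.
rewrite -mulrA; apply: ler_pM => //.
by rewrite -(real_normK (num_real (Y b - Y a))) expr2; exact: ler_wpM2r.
Qed.

End green_rectangle.
End plane_calculus.

(** * Exchanging the axes; Young integrals as limits *)

Section swap.
Context {R : realType}.
Notation mu2 := (@lebesgue_measure R \x @lebesgue_measure R)%E.

Definition swap (z : R * R) : R * R := (z.2, z.1).

Lemma continuous_swap : continuous swap.
Proof.
move=> z A /nbhs_ballP[e /= e0 hA]; apply/nbhs_ballP; exists e => //= w [h1 h2].
by apply: hA; split.
Qed.

Lemma continuous_partials_swap (g : R * R -> R) :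
  continuous_partials g -> continuous_partials (g \o swap).
Proof.
move=> [dx dy cx cy]; split.
- by move=> z; exact: (dy (swap z)).
- by move=> z; exact: (dx (swap z)).
- rewrite (_ : partial_x _ = partial_y g \o swap); last by apply/funext.
  by move=> z; apply: continuous_comp; [exact: continuous_swap|exact: cy].
- rewrite (_ : partial_y _ = partial_x g \o swap); last by apply/funext.
  by move=> z; apply: continuous_comp; [exact: continuous_swap|exact: cx].
Qed.

(** The box is invariant under the swap, so both sides are the two iterated integrals of one
    function. *)
Lemma Rintegral_swap_box (F : R * R -> R) M :
  mu2.-integrable (centered_box M) (EFin \o F) ->
  mu2.-integrable (centered_box M) (EFin \o (F \o swap)) ->
  (\int[mu2]_(z in centered_box M) F (swap z) =
   \int[mu2]_(z in centered_box M) F z)%R.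
Proof.
have ik (G : R * R -> R) : mu2.-integrable (centered_box M) (EFin \o G) ->
    mu2.-integrable setT (EFin \o (G \_ (centered_box M))).
  move=> iG; rewrite -restrict_EFin; apply/(integrable_restrict _ _ _) => //.
    exact: measurable_centered_box.
  by rewrite setTI.
move=> /ik i1 /ik i2.
rewrite [LHS]Rintegral_mkcond [RHS]Rintegral_mkcond /Rintegral; congr fine.
rewrite -(integral12_prod_meas1 i2) -(integral21_prod_meas1 i1).
apply: eq_integral => u _; apply: eq_integral => v _ /=.
by rewrite !patchE !in_setX andbC.
Qed.

End swap.

Section integral_bounds.
Context {R : realType}.
Notation mu2 := (@lebesgue_measure R \x @lebesgue_measure R)%E.

Lemma Rintegral_box_bound (h k : R * R -> R) (M H c : R) :
  measurable_fun setT h -> measurable_fun setT k -> 0 <= H ->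
  (forall z, centered_box M z -> `|h z| <= H) ->
  (\int[mu2]_(z in centered_box M) `|k z|%:E <= c%:E)%E ->
  mu2.-integrable (centered_box M) (EFin \o (fun z => h z * k z)) /\
  `|(\int[mu2]_(z in centered_box M) (h z * k z))%R| <= H * c.
Proof.
move=> mh mk H0 hH kc.
have mbox := measurable_centered_box M.
have mhk : measurable_fun setT (fun z => h z * k z) by exact: measurable_funM.
have hkc : (\int[mu2]_(z in centered_box M) `|h z * k z|%:E <= (H * c)%:E)%E.
  apply: (@le_trans _ _ (\int[mu2]_(z in centered_box M) (H%:E * `|k z|%:E))%E).
    apply: ge0_le_integral.
    - exact: mbox.
    - by move=> z _; rewrite lee_fin.
    - by apply: measurable_funTS; apply/measurable_EFinP; exact: measurableT_comp.
    - apply: measurable_funTS; apply: emeasurable_funM; first exact: measurable_cst.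
      by apply/measurable_EFinP; exact: measurableT_comp.
    - by move=> z Mz; rewrite -EFinM lee_fin normrM ler_wpM2r// hH.
  rewrite ge0_integralZl//; last first.
    by apply: measurable_funTS; apply/measurable_EFinP; exact: measurableT_comp.
  by rewrite EFinM lee_wpmul2l// lee_fin.
have ihk : mu2.-integrable (centered_box M) (EFin \o (fun z => h z * k z)).
  apply/integrableP; split.
    by apply: measurable_funTS; exact/measurable_EFinP.
  by apply: le_lt_trans hkc _; exact: ltry.
split => //; rewrite -lee_fin; apply: le_trans hkc.
rewrite EFin_normr_Rintegral//; apply: le_abse_integral; first exact: mbox.
by apply: measurable_funTS; exact/measurable_EFinP.
Qed.

End integral_bounds.

(** * Evaluating Young integrals *)

Section young_limit.
Context {R : realType}.

Lemma fine_step_partition (d : R) s : 0 < d -> path (fine_step d) 0 s ->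
  last 0 s = 1 -> itv_partition 0 1 s /\ mesh s < d.
Proof.
move=> d0 ps ls; split.
  split; last by rewrite ls.
  by apply: sub_path ps => a b /and4P[].
apply: bigmax_lt => // i _; have /(pathP 1)/(_ i (ltn_ord i)) := ps.
by case/and4P.
Qed.

#[local] Instance mesh_to_0_proper : ProperFilter (@mesh_to_0 R).
Proof.
apply: filter_from_proper.
  apply: filter_from_filter; first by exists 1 => /=.
  move=> i j /= i0 j0; exists (Num.min i j); first by rewrite /= lt_min i0.
  by move=> s /= [ps]; rewrite lt_min => /andP[mi mj].
move=> d /= d0; have [s ps ls] := exists_partition d0.
by exists s; exact: fine_step_partition.
Qed.

(** Since [young_integral] is a total [lim], an explicit estimate against I supplies convergence and
    value together. *)
Lemma young_integralE (phi psi : R -> R) (I : R) :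
  (forall e, 0 < e -> exists2 d, 0 < d & forall s, path (fine_step d) 0 s ->
    last 0 s = 1 ->
    `|csum (fun a b => phi a * (psi b - psi a)) 0 s - I| <= e) ->
  young_integral phi psi = I.
Proof.
move=> hI; apply: cvg_lim; first exact: norm_hausdorff.
apply/cvgrPdist_le => e e0; have [d d0 hd] := hI _ e0.
exists d => //= s [ps ms].
have -> : young_sum phi psi s = csum (fun a b => phi a * (psi b - psi a)) 0 s.
  exact: (csum_nth 1 (fun a b => phi a * (psi b - psi a)) 0 s).
rewrite distrC; apply: hd; first exact: partition_fine_step.
by case: ps => _ /eqP.
Qed.

End young_limit.

(** * Green's theorem *)

Section stair_by_parts.
Context {R : realType}.
Notation mu2 := (@lebesgue_measure R \x @lebesgue_measure R)%E.
Implicit Types X Y : R -> R.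

Definition corner_step X Y a b (z : R * R) : R :=
  (step (X b) z.1 - step (X a) z.1) * (step (Y b) z.2 - step (Y a) z.2).

Definition corners X Y a s (z : R * R) : R :=
  csum (fun b c => corner_step X Y b c z) a s.

Lemma measurable_corner_step X Y a b :
  measurable_fun setT (corner_step X Y a b).
Proof.
by apply: measurable_funM; apply: measurable_funB;
  do ?[exact: measurable_step1|exact: measurable_step2].
Qed.

Lemma measurable_corners X Y a s : measurable_fun setT (corners X Y a s).
Proof. by apply: measurable_csum => *; exact: measurable_corner_step. Qed.

Lemma L1norm_corners X Y a s : (L1norm (corners X Y a s) <=
  (csum (fun b c => `|X c - X b| * `|Y c - Y b|) a s)%:E)%E.
Proof.
elim: s a => [|b s IH] a.
  by rewrite (_ : corners X Y a [::] = fun=> 0)// L1norm0.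
apply: (le_trans (L1normD (measurable_corner_step X Y a b) (measurable_corners X Y b s))).
by rewrite /= EFinD; apply: leeD; rewrite ?IH// L1norm_rect.
Qed.

(** The discrete product rule d(xy) = x dy + y dx + dx dy for step functions, summed around the
    closed curve; [corners] collects the second-order terms. *)
Lemma stair_by_parts X Y s z : X 0 = X 1 -> Y 0 = Y 1 -> last 0 s = 1 ->
  stair Y X 0 s (swap z) = - stair X Y 0 s z - corners X Y 0 s z.
Proof.
move=> X01 Y01 ls; pose G t := step (X t) z.1 * step (Y t) z.2.
have : csum (fun a b => G b - G a) 0 s = 0.
  by rewrite csum_telescope ls /G X01 Y01 subrr.
have -> : csum (fun a b => G b - G a) 0 s = csum (fun a b =>
    stair_step X Y a b z + stair_step Y X a b (swap z) + corner_step X Y a b z) 0 s.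
  elim: s (0 : R) {ls} => [//|b s IH] a /=; rewrite IH; congr (_ + _).
  rewrite /G /stair_step /corner_step /swap /=; ring.
by rewrite !csumD -/(stair X Y 0 s z) -/(stair Y X 0 s (swap z))
  -/(corners X Y 0 s z) => h; lra.
Qed.

End stair_by_parts.

Section young_green.
Context {R : realType}.
Notation mu2 := (@lebesgue_measure R \x @lebesgue_measure R)%E.
Variables (gamma : R -> R * R) (p : R).
Let X t := (gamma t).1.
Let Y t := (gamma t).2.
Hypothesis p1 : 1 <= p.
Hypothesis p2 : p < 2.
Hypothesis cgamma : {within `[0, 1], continuous gamma}.
Hypothesis closed_gamma : gamma 0 = gamma 1.
Hypothesis gamma_pos : positively_oriented gamma.
Hypothesis gamma_pvar : finite_pvariation p gamma.
Variable M : R.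
Hypothesis hM : forall t, 0 <= t <= 1 -> `|X t| < M /\ `|Y t| < M.

Let J := jordan_int gamma.
Let box := centered_box M.

Lemma measurable_jordan_int : measurable J.
Proof. exact: open_measurable_plane (open_jordan_int cgamma closed_gamma gamma_pos). Qed.

Lemma jordan_int_sub_box : J `<=` box.
Proof.
move=> z /(jordan_int_bounded cgamma closed_gamma gamma_pos hM).
by move=> [/ltr_normlP[? ?] /ltr_normlP[? ?]]; split; rewrite /= in_itv/=; lra.
Qed.

Lemma Rintegral_jordan_int (h : R * R -> R) :
  (\int[mu2]_(z in J) h z = \int[mu2]_(z in box) (h z * \1_J z))%R.
Proof.
rewrite -[in LHS](setIidr jordan_int_sub_box) Rintegral_mkcondr.
apply: eq_Rintegral => z _; rewrite patchE indicE.
by case: ifPn; rewrite ?mulr1 ?mulr0.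
Qed.

(** Passes from the complement of the curve, where staircases converge, to the box; the curve is
    null. *)
Lemma integral_box_off_curve (k : R * R -> R) : measurable_fun setT k ->
  (\int[mu2]_(z in box) `|k z|%:E <=
   \int[mu2]_(z in ~` curve_image gamma) `|k z|%:E)%E.
Proof.
move=> mk; have mbox := measurable_centered_box M.
have mD : measurable (~` curve_image gamma).
  exact: open_measurable_plane (open_off_curve cgamma).
have mI : measurable (curve_image gamma).
  by rewrite -[curve_image _]setCK; exact: measurableC.
have mabs : measurable_fun setT (fun z => `|k z|%:E).
  by apply/measurable_EFinP; exact: measurableT_comp.
have muI := curve_image_null cgamma p1 p2 gamma_pvar.
have -> : (\int[mu2]_(z in box) `|k z|%:E =
    \int[mu2]_(z in box `\` curve_image gamma) `|k z|%:E)%E.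
  apply: ge0_negligible_integral.
  - exact: mI.
  - exact: mbox.
  - exact: measurable_funTS.
  - by move=> z _; rewrite lee_fin.
  - exact: muI.
apply: ge0_subset_integral.
- exact: measurableD.
- exact: mD.
- exact: measurable_funTS.
- by move=> z _; rewrite lee_fin.
- by move=> z [].
Qed.

Lemma measurable_stair_error s :
  measurable_fun setT (fun z => stair X Y 0 s z - \1_J z).
Proof.
apply: measurable_funB; first exact: measurable_stair.
by apply: measurable_indic; exact: measurable_jordan_int.
Qed.

Lemma integrable_interior (h : R * R -> R) : continuous h ->
  mu2.-integrable box (EFin \o (fun z => h z * \1_J z)).
Proof.
move=> ch; have [H H0 hH] := continuous_bounded_on_box M ch.
apply: (@integrable_on_box _ _ M H).
  apply: measurable_funM; first exact: continuous_measurable_plane.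
  by apply: measurable_indic; exact: measurable_jordan_int.
move=> z Mz; rewrite indicE normrM normr_nat.
by case: (_ \in _); rewrite ?mulr1 ?mulr0// hH.
Qed.

Lemma integrable_jordan_int (h : R * R -> R) : continuous h ->
  mu2.-integrable J (EFin \o h).
Proof.
move=> ch; have [H H0 hH] := continuous_bounded_on_box M ch.
have ibox := integrable_on_box (continuous_measurable_plane ch) hH.
refine (integrableS _ _ _ ibox).
- exact: measurable_centered_box.
- exact: measurable_jordan_int.
- exact: jordan_int_sub_box.
Qed.

Lemma integral_stair_close (h : R * R -> R) H eps s : continuous h -> 0 <= H ->
  (forall z, box z -> `|h z| <= H) ->
  (\int[mu2]_(z in ~` curve_image gamma) `|stair X Y 0 s z - \1_J z|%:E <= eps%:E)%E ->
  mu2.-integrable box (EFin \o (fun z => h z * stair X Y 0 s z)) /\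
  `|(\int[mu2]_(z in box) (h z * stair X Y 0 s z))%R -
    (\int[mu2]_(z in J) h z)%R| <= H * eps.
Proof.
move=> ch H0 hH hs; have mh := continuous_measurable_plane ch.
have mbox := measurable_centered_box M.
have mk := measurable_stair_error s.
have [ik bk] := Rintegral_box_bound mh mk H0 hH (le_trans (integral_box_off_curve mk) hs).
have iJ := integrable_interior ch.
have E : (fun z => h z * stair X Y 0 s z) =
    (fun z => h z * (stair X Y 0 s z - \1_J z) + h z * \1_J z).
  by apply/funext => z; rewrite mulrBr subrK.
rewrite E Rintegral_jordan_int; split; first by apply: (integrableD _ ik iJ); exact: mbox.
by rewrite RintegralD// addrK.
Qed.

Lemma young_green_x (f : R * R -> R) : continuous_partials f ->
  young_integral (fun s => f (gamma s)) Y = (\int[mu2]_(z in J) partial_x f z)%R.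
Proof.
move=> hf; have [_ _ cfx _] := hf; have [H H0 hH] := continuous_bounded_on_box M cfx.
have [L L0 hL] := stair_green M hf.
apply: young_integralE => e e0.
have LH : 0 < L + H + 1 by lra.
(* L eps comes from [stair_green] and H eps from the L^1 distance to the indicator. *)
have eps0 : 0 < e / (L + H + 1) by rewrite divr_gt0.
have [d d0 hd] := stair_L1_close cgamma closed_gamma gamma_pos p1 p2 gamma_pvar eps0.
exists d => // s ps ls; have [hs _ hy _] := hd _ ps ls.
have [_ close] := integral_stair_close cfx H0 hH hs.
have Y01 : Y 0 = Y 1 by rewrite /Y closed_gamma.
have green := hL X Y d s hM Y01 ps ls.
have fE : csum (fun a b => f (gamma a) * (Y b - Y a)) 0 s =
    csum (fun a b => f (X a, Y a) * (Y b - Y a)) 0 s.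
  by apply: (eq_csum ps) => a b _; rewrite /X /Y -surjective_pairing.
rewrite fE; apply: (le_trans (ler_distD
  (\int[mu2]_(z in box) (partial_x f z * stair X Y 0 s z))%R _ _)).
apply: (le_trans (lerD green close)).
set eps := e / _ in eps0 hy *.
have -> : e = (L + H + 1) * eps by rewrite /eps mulrC divfK ?gt_eqF.
have := ler_wpM2l L0 hy; lra.
Qed.

(** [stair_green] is applied to g with the axes exchanged. The minus sign and the corner terms come
    from [stair_by_parts]; the corners cost a second H eps. *)
Lemma young_green_y (g : R * R -> R) : continuous_partials g ->
  young_integral (fun s => g (gamma s)) X = - (\int[mu2]_(z in J) partial_y g z)%R.
Proof.
move=> hg; have [_ _ _ cgy] := hg; have [H H0 hH] := continuous_bounded_on_box M cgy.
have hgs := continuous_partials_swap hg.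
have [L L0 hL] := stair_green M hgs.
have mbox := measurable_centered_box M.
apply: young_integralE => e e0.
have LH : 0 < L + H + H + 1 by lra.
have eps0 : 0 < e / (L + H + H + 1) by rewrite divr_gt0.
have [d d0 hd] := stair_L1_close cgamma closed_gamma gamma_pos p1 p2 gamma_pvar eps0.
exists d => // s ps ls; have [hs hx _ hxy] := hd _ ps ls.
have [istair close] := integral_stair_close cgy H0 hH hs.
have X01 : X 0 = X 1 by rewrite /X closed_gamma.
have Y01 : Y 0 = Y 1 by rewrite /Y closed_gamma.
have hM' t : 0 <= t <= 1 -> `|Y t| < M /\ `|X t| < M by move=> /hM[].
have green := hL Y X d s hM' X01 ps ls.
have [icorner corner] : mu2.-integrable box
      (EFin \o (fun z => partial_y g z * corners X Y 0 s z)) /\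
    `|(\int[mu2]_(z in box) (partial_y g z * corners X Y 0 s z))%R| <=
      H * (e / (L + H + H + 1)).
  apply: (Rintegral_box_bound _ _ H0 hH).
  - exact: continuous_measurable_plane.
  - exact: measurable_corners.
  apply: (@le_trans _ _ (L1norm (corners X Y 0 s))).
    apply: ge0_subset_integral; [exact: mbox|exact: measurableT| | |by []].
      by apply/measurable_EFinP; apply: measurableT_comp => //; exact: measurable_corners.
    by move=> z _; rewrite lee_fin.
  by apply: (le_trans (L1norm_corners X Y 0 s)); rewrite lee_fin.
pose G z := partial_y g z * stair Y X 0 s (swap z).
have GE : G = (fun z => - (partial_y g z * stair X Y 0 s z) -
    partial_y g z * corners X Y 0 s z).
  by apply/funext => z; rewrite /G stair_by_parts//; ring.
have iN : mu2.-integrable box (EFin \o (fun z => - (partial_y g z * stair X Y 0 s z))).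
  exact: integrableN istair.
have iG : mu2.-integrable box (EFin \o G).
  by rewrite GE; apply: (integrableB _ iN icorner); exact: mbox.
have [iGs _] := primitive_stair M hgs Y X 0 s.
have swapE := Rintegral_swap_box iG iGs.
have intG : (\int[mu2]_(z in box) G z)%R =
    - (\int[mu2]_(z in box) (partial_y g z * stair X Y 0 s z))%R -
    (\int[mu2]_(z in box) (partial_y g z * corners X Y 0 s z))%R.
  rewrite GE RintegralB//; congr (_ - _).
  rewrite -mulN1r -RintegralZl//; apply: eq_Rintegral => z _.
  by rewrite mulN1r.
move: green; rewrite swapE intG.
have -> : csum (fun a b => (g \o swap) (Y a, X a) * (X b - X a)) 0 s =
    csum (fun a b => g (gamma a) * (X b - X a)) 0 s.
  by apply: (eq_csum ps) => a b _; rewrite /X /Y /= /swap/= -surjective_pairing.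
move: close corner.
set A := Rintegral _ _ _; set B := Rintegral _ _ _; set C := Rintegral _ _ _.
set eps := e / _ in eps0 hx *.
have -> : e = (L + H + H + 1) * eps by rewrite /eps mulrC divfK ?gt_eqF.
move=> /ler_normlP[c1 c2] /ler_normlP[c3 c4] /ler_normlP[c5 c6].
have := ler_wpM2l L0 hx => hx'.
by apply/ler_normlP; split; lra.
Qed.

End young_green.

Theorem theorem3p2 (R : realType) (f g : R * R -> R) (p : R)
    (gamma : R -> R * R)
    (hf : continuous_partials f) (hg : continuous_partials g)
    (hp : 1 <= p < 2)
    (gamma_jordan : jordan_curve gamma)
    (gamma_pos : positively_oriented gamma)
    (gamma_pvar : finite_pvariation p gamma) :
  let x := fun s => (gamma s).1 in
  let y := fun s => (gamma s).2 in
  (young_integral (fun s => f (gamma s)) y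
     - young_integral (fun s => g (gamma s)) x)%:E
  = (\int[(lebesgue_measure \x lebesgue_measure)%E]_(z in jordan_int gamma)
       (partial_x f z + partial_y g z)%:E)%E.
Proof.
move=> x y; have [cgamma closed_gamma _] := gamma_jordan.
have /andP[p1 p2] := hp; have [M M0 hM] := curve_bounded cgamma.
have [_ _ cfx _] := hf; have [_ _ _ cgy] := hg.
have mJ := measurable_jordan_int cgamma closed_gamma gamma_pos.
have ifx := integrable_jordan_int cgamma closed_gamma gamma_pos hM cfx.
have igy := integrable_jordan_int cgamma closed_gamma gamma_pos hM cgy.
rewrite (young_green_x p1 p2 cgamma closed_gamma gamma_pos gamma_pvar hM hf).
rewrite (young_green_y p1 p2 cgamma closed_gamma gamma_pos gamma_pvar hM hg).
rewrite opprK -RintegralD//.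
rewrite /Rintegral fineK//; apply: integrable_fin_num; first exact: mJ.
by apply: (integrableD _ ifx igy); exact: mJ.
Qed.
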